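(* There is a polynomial-time algorithm that, given a tight graph $G$ with set $T$ of dense vertices, a set $S'\subseteq\delta T$, and an $S'$-partial b-colouring $c'$ of $G$, decides whether $c'$ has a b-precolouring extension in $G$.
   Context: A colouring of $G$ is a map $c:V(G)\to\mathbb{Z}^+$ with adjacent vertices receiving distinct colours. A vertex is b-chromatic under $c$ if it is adjacent to a vertex of every colour used by $c$ other than its own; a b-colouring is a colouring in which every colour class has a b-chromatic vertex. $m(G)$ is the largest $k$ such that $G$ has at least $k$ vertices of degree at least $k-1$; a vertex of degree at least $m(G)-1$ is dense; $G$ is tight if it has exactly $m(G)$ dense vertices, each of degree exactly $m(G)-1$. For $T\subseteq V(G)$, $\delta T=\left(\bigcup_{u\in T}N(u)\right)\setminus T$. Let $G$ be tight with dense set $T$ and let $S'\subseteq\delta T$. An $S'$-partial b-colouring of $G$ is a colouring $c'$ of $G[S'\cup T]$ such that (1) $c'(u)\neq c'(u')$ for all distinct $u,u'\in T$, and (2) for every $u\in T$ such that $c'(u)=c'(s)$ for some $s\in S'$, every vertex of $T\setminus\{u\}$ has exactly one neighbour in $S'\cup T$ of colour $c'(u)$. A b-colouring $c$ of $G$ is a b-precolouring extension of $c'$ if (1) $c(v)=c'(v)$ for all $v\in S'\cup T$, and (2) every colour class of $c$ containing at least two vertices of $\delta T$ contains no vertex of $\delta T\setminus S'$. *)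

(* Defs.v *)
From mathcomp Require Import all_boot.
Set Implicit Arguments. Unset Strict Implicit. Unset Printing Implicit Defensive.

(* Graphs: a simple graph on vertex set 'I_n is a symmetric irreflexive
   relation e : rel 'I_n (symmetry/irreflexivity are hypotheses).     *)
Section Graph.
Variables (n : nat) (e : rel 'I_n).

Definition deg (v : 'I_n) : nat := #|[set u | e v u]|.

Definition mG : nat :=
  \max_(k < n.+1 | k <= #|[set v | k.-1 <= deg v]|) k.

Definition dense (v : 'I_n) : bool := (mG.-1 <= deg v).
Definition denseSet : {set 'I_n} := [set v | dense v].

Definition tight : Prop :=
  #|denseSet| = mG /\ forall v, v \in denseSet -> deg v = mG.-1.

Definition deltaT (T : {set 'I_n}) : {set 'I_n} :=
  [set u | [exists t in T, e t u] && (u \notin T)].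

Definition colouring (c : 'I_n -> nat) : Prop :=
  (forall v, 0 < c v) /\ (forall u v, e u v -> c u <> c v).

Definition colour_used (c : 'I_n -> nat) (k : nat) : Prop := exists v, c v = k.

Definition b_chromatic (c : 'I_n -> nat) (v : 'I_n) : Prop :=
  forall k, colour_used c k -> k <> c v -> exists u, e v u /\ c u = k.

Definition b_colouring (c : 'I_n -> nat) : Prop :=
  colouring c /\
  forall k, colour_used c k -> exists v, c v = k /\ b_chromatic c v.

(* S'-partial b-colouring (T = dense set): a colouring c' of G[S' u T],
   represented by a total map whose values outside S' u T are ignored. *)
Definition partial_b_colouring (S' : {set 'I_n}) (c' : 'I_n -> nat) : Prop :=
  let T := denseSet in
  let D := S' :|: T in
  (forall v, v \in D -> 0 < c' v) /\
  (forall u v, u \in D -> v \in D -> e u v -> c' u <> c' v) /\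
  (forall u u', u \in T -> u' \in T -> u <> u' -> c' u <> c' u') /\
  (forall u, u \in T -> (exists2 s, s \in S' & c' u = c' s) ->
     forall w, w \in T :\ u -> #|[set x in D | e w x && (c' x == c' u)]| = 1).

Definition b_precolouring_extension (S' : {set 'I_n}) (c' c : 'I_n -> nat)
  : Prop :=
  let T := denseSet in
  b_colouring c /\
  (forall v, v \in S' :|: T -> c v = c' v) /\
  (forall k, 2 <= #|[set v in deltaT T | c v == k]| ->
     forall v, v \in deltaT T :\: S' -> c v <> k).

Definition has_b_precolouring_extension (S' : {set 'I_n}) (c' : 'I_n -> nat)
  : Prop := exists c, b_precolouring_extension S' c' c.

End Graph.

Inductive sym := S0 | S1 | SH.
Inductive move := MoveL | MoveR | Stay.

Record TM := {
  tm_Q : finType;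
  tm_G : finType;
  tm_blank : tm_G;
  tm_in : sym -> tm_G;
  tm_start : tm_Q;
  tm_delta : tm_Q -> tm_G -> option (tm_Q * tm_G * move);
  tm_acc : pred tm_Q }.

Section TMrun.
Variable M : TM.
(* configuration: state, tape left of head (reversed), tape from head on *)
Definition config := (tm_Q M * seq (tm_G M) * seq (tm_G M))%type.

Definition step (c : config) : option config :=
  let: (q, l, r) := c in
  let a := head (@tm_blank M) r in
  match @tm_delta M q a with
  | None => None
  | Some (q', b, m) =>
      let r' := b :: behead r in
      Some (match m with
            | Stay => (q', l, r')
            | MoveR => (q', b :: l, behead r')
            | MoveL => match l with
                       | [::] => (q', [::], @tm_blank M :: r')
                       | x :: l' => (q', l', x :: r')
                       end
            end)
  end.

Fixpoint run (t : nat) (c : config) : config :=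
  match t with
  | 0 => c
  | t'.+1 => match step c with None => c | Some c' => run t' c' end
  end.

Definition init (w : seq sym) : config := (@tm_start M, [::], map (@tm_in M) w).

Definition halted (c : config) : bool := if step c is None then true else false.
Definition accepting (c : config) : bool := @tm_acc M c.1.1.
End TMrun.

(* Encoding of an instance (G, S', c') as a word over {0,1,#}.          *)
(* Vertices are 0..n-1; for each vertex v we write its adjacency row,   *)
(* '#', the bit [v \in S'], '#', the colour c'(v) in binary (0 if       *)
(* v \notin S' u T, where c' is undefined), '#'.  T is determined by G. *)
Definition bit (b : bool) : sym := if b then S1 else S0.

Definition nat_bits (m : nat) : seq sym :=
  (fix go k m := match k with
                 | 0 => [::]
                 | k'.+1 => if m is 0 then [::] else bit (odd m) :: go k' m./2
                 end) m m.

Definition encode (n : nat) (e : rel 'I_n) (S' : {set 'I_n}) (c' : 'I_n -> nat)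
  : seq sym :=
  flatten [seq [seq bit (e v u) | u <- enum 'I_n] ++ [:: SH; bit (v \in S'); SH]
                ++ nat_bits (if v \in S' :|: denseSet e then c' v else 0) ++ [:: SH]
          | v <- enum 'I_n].

(* Main.v *)
Require Import Defs.
From mathcomp Require Import all_boot zify.
Set Implicit Arguments. Unset Strict Implicit. Unset Printing Implicit Defensive.

(* In an extension every dense vertex is b-chromatic and, having degree
   m(G) - 1, sees each other colour exactly once.  A vertex r of deltaT \ S'
   shares its colour with exactly one dense vertex u, no vertex of S' has that
   colour, and r is then adjacent to precisely the dense vertices outside N[u].
   Hence the bipartite matching problem between deltaT \ S' and the dense
   vertices of free colour splits into complete bipartite pieces, indexed by
   subsets of T, and is decided by comparing cardinalities.  Vertices outside
   T and deltaT have degree below m(G) - 1 and are coloured greedily.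

   The resulting criterion is a first-order formula with counting over the
   positions of the input word.  Such formulas are evaluated in polynomial time
   by a one-tape machine that stores the value of each variable as a mark on the
   tape and performs every elementary operation by one sweep over the tape. *)

(** * The counting criterion *)

Section Criterion.
Variables (n : nat) (e : rel 'I_n) (S' : {set 'I_n}) (c' : 'I_n -> nat).
Hypotheses (e_sym : symmetric e) (e_irr : irreflexive e) (tightG : tight e).
Hypothesis (hS : S' \subset deltaT e (denseSet e)).
Hypothesis (hc' : partial_b_colouring e S' c').

Let T := denseSet e.
Let dT := deltaT e T.

Definition type_in (r : 'I_n) : {set 'I_n} := [set w in denseSet e | e r w].
(** The type that a vertex of [rest] must have in order to take the colour of [u]. *)
Definition cotype_in (u : 'I_n) : {set 'I_n} :=
  [set w in denseSet e | ~~ (e u w || (w == u))].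
Definition free_dense : {set 'I_n} :=
  [set u in denseSet e | [forall s in S', c' s != c' u]].
Definition rest : {set 'I_n} := deltaT e (denseSet e) :\: S'.

Definition criterion : Prop :=
  (forall s, s \in S' -> exists2 t, t \in denseSet e & c' s = c' t) /\
  (forall r, r \in rest ->
     #|[set r' in rest | type_in r' == type_in r]| <=
     #|[set u in free_dense | cotype_in u == type_in r]|).

Lemma dense_inj u u' : u \in T -> u' \in T -> c' u = c' u' -> u = u'.
Proof.
move=> hu hu' h; case: hc' => _ [_ [h3 _]].
by apply/eqP; apply/negP => /negP/eqP hne; apply: (h3 u u').
Qed.

Lemma deltaT_notin v : v \in dT -> v \notin T.
Proof. by rewrite inE => /andP[]. Qed.

Lemma nbr_cases t x : t \in T -> e t x -> x \notin T -> x \in dT.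
Proof.
by move=> ht hx hn; rewrite inE hn andbT; apply/exists_inP; exists t.
Qed.

(** * Necessity of the criterion *)

Section Necessity.
Variable c : 'I_n -> nat.
Hypothesis hc : b_precolouring_extension e S' c' c.

Lemma ext_on_T t : t \in T -> c t = c' t.
Proof. by move=> ht; case: hc => _ [-> //]; rewrite inE ht orbT. Qed.

Lemma ext_inj_T u u' : u \in T -> u' \in T -> c u = c u' -> u = u'.
Proof. by move=> hu hu'; rewrite !ext_on_T //; apply: dense_inj. Qed.

Let cols := undup [seq c v | v <- enum 'I_n].

Lemma mem_cols v : c v \in cols.
Proof. by rewrite mem_undup map_f // mem_enum. Qed.

Lemma b_chromatic_deg v : b_chromatic e c v -> (size cols).-1 <= deg e v.
Proof.
move=> hv; have sub : {subset rem (c v) cols <= [seq c u | u in [set u | e v u]]}.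
  move=> k; rewrite mem_rem_uniq ?undup_uniq // inE => /andP[hk].
  rewrite mem_undup => /mapP[x _ hx].
  have [||u [hu huk]] := hv k; [by exists x | exact/eqP |].
  by rewrite -huk; apply: image_f; rewrite inE.
have := uniq_leq_size (rem_uniq (c v) (undup_uniq _)) sub.
by rewrite size_rem ?mem_cols // size_map -cardE.
Qed.

(** Every colour has a b-chromatic vertex, of degree at least [(size cols).-1], so [size cols] is a
    candidate in the maximum defining [mG]. Conversely the [mG e] dense vertices have distinct
    colours. *)
Lemma size_cols : size cols = mG e.
Proof.
have [hcol hb] := hc.1; have [hT _] := tightG.
have hK : size cols <= n.
  by rewrite (leq_trans (size_undup _)) // size_map size_enum_ord.
apply/eqP; rewrite eqn_leq; apply/andP; split; last first.
  rewrite -hT cardE -(size_map c); apply: uniq_leq_size.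
    by rewrite map_inj_in_uniq ?enum_uniq // => x y; rewrite !mem_enum; apply: ext_inj_T.
  by move=> k /mapP[t _ ->]; apply: mem_cols.
rewrite -[leqLHS](inordK (n' := n) (m := size cols)) //.
apply: (@leq_bigmax_cond _ _ (fun i : 'I_n.+1 => i : nat)).
rewrite inordK //.
suff sub : {subset cols <= [seq c v | v in [set v | (size cols).-1 <= deg e v]]}.
  by have := uniq_leq_size (undup_uniq _) sub; rewrite size_map -cardE.
move=> k; rewrite mem_undup => /mapP[v _ ->].
have [|u [hu hbu]] := hb (c v); first by exists v.
by rewrite -hu; apply: image_f; rewrite inE b_chromatic_deg.
Qed.

(** By counting, the distinct colours of the dense vertices exhaust [cols]. *)
Lemma cols_T v : exists2 t, t \in T & c v = c t.
Proof.
have [hT _] := tightG.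
have u1 : uniq [seq c t | t <- enum T].
  rewrite map_inj_in_uniq ?enum_uniq // => x y; rewrite !mem_enum; exact: ext_inj_T.
have sub : {subset [seq c t | t <- enum T] <= cols}.
  by move=> k /mapP[t _ ->]; apply: mem_cols.
have [_ h] := uniq_min_size u1 sub ltac:(by rewrite size_map -cardE hT size_cols).
have := mem_cols v; rewrite -h => /mapP[t ht ->]; exists t => //.
by rewrite mem_enum in ht.
Qed.

(** The b-chromatic vertex of colour [c t] has degree large enough to be dense, and colours are
    injective on [T]. *)
Lemma T_b_chromatic t : t \in T -> b_chromatic e c t.
Proof.
move=> ht; case: hc => -[_ hb] _.
have [|v [hv hbv]] := hb (c t); first by exists t.
suff -> : t = v by [].
apply: ext_inj_T => //.
by rewrite inE /dense -size_cols; apply: b_chromatic_deg.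
Qed.

(* Counting: the degree of t is one less than the number of colours. *)
Lemma T_nbr_inj t x y : t \in T -> e t x -> e t y -> c x = c y -> x = y.
Proof.
move=> ht hx hy hxy; apply/eqP/negP => /negP hne.
have [_ /(_ t ht) hdeg] := tightG.
have hb := T_b_chromatic ht.
have sub : {subset rem (c t) cols <= [seq c u | u in [set u | e t u] :\ x]}.
  move=> k; rewrite mem_rem_uniq ?undup_uniq // inE => /andP[hk].
  rewrite mem_undup => /mapP[z _ hz].
  have [||u [hu huk]] := hb k; [by exists z | exact/eqP |].
  rewrite -huk; have [->|hux] := eqVneq u x; last by apply: image_f; rewrite !inE hux.
  by rewrite hxy; apply: image_f; rewrite !inE eq_sym hne.
have := uniq_leq_size (rem_uniq (c t) (undup_uniq _)) sub.
rewrite size_rem ?mem_cols // size_map -cardE size_cols -hdeg.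
by rewrite /deg (cardsD1 x [set u | e t u]) inE hx add1n ltnn.
Qed.

(** A class containing two vertices of [dT] may not meet [rest]. *)
Lemma rest_unique r x : r \in rest -> x \in dT -> c x = c r -> x = r.
Proof.
move=> hr hx hxr; apply/eqP/negP => /negP hne; case: hc => _ [_ /(_ (c r))] h.
apply: (h _ r hr erefl).
have <- : #|[set x; r]| = 2 by rewrite cards2 hne.
apply: subset_leq_card; apply/subsetP => v; rewrite in_set2 inE.
move=> /orP[/eqP->|/eqP->]; first by rewrite hx hxr /=.
by move: hr; rewrite inE => /andP[_ ->] /=.
Qed.

Lemma criterion_necessary : criterion.
Proof.
have [[[_ hprop] _] [hcc' _]] := hc.
have exg v : exists t, (t \in T) && (c v == c t).
  by have [t ht hv] := cols_T v; exists t; rewrite ht hv eqxx.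
(* [g v] is the dense vertex with the colour of [v]. On [rest] it is a type-preserving injection
   into [free_dense], which yields the inequality of cardinalities. *)
pose g v := xchoose (exg v).
have gT v : g v \in T by have /andP[] := xchooseP (exg v).
have gc v : c v = c (g v) by apply/eqP; have /andP[] := xchooseP (exg v).
have restT r : r \in rest -> r \notin T.
  by rewrite inE => /andP[_ /deltaT_notin].
split=> [s hs|r hr].
  by exists (g s); rewrite ?gT // -(ext_on_T (gT s)) -gc hcc' // inE hs.
have g_free r' : r' \in rest -> g r' \in free_dense.
  move=> hr'; rewrite inE gT; apply/forall_inP => s hs; apply/eqP => hsg.
  have hsd := subsetP hS _ hs.
  have := rest_unique hr' hsd; rewrite hcc' ?inE ?hs // hsg -(ext_on_T (gT _)) -gc.
  by move=> /(_ erefl) hsr; move: hr'; rewrite -hsr inE hs.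
have g_type r' : r' \in rest -> cotype_in (g r') = type_in r'.
  move=> hr'; apply/setP => w; rewrite !inE; case hw: (dense e w) => //=.
  have hwT : w \in T by rewrite inE.
  (* If [r'] is adjacent to [w], then [g r'] is not, since neighbours of [w] have distinct
     colours. *)
  have [hrw|hrw] := boolP (e r' w).
    rewrite negb_or; apply/andP; split.
      apply/negP => hgw; have := restT _ hr'.
      rewrite (T_nbr_inj hwT (x := r') (y := g r')) ?gT // e_sym //.
    by apply/eqP => hwg; case: (hprop r' w) => //; rewrite hwg.
  apply/negbTE; rewrite negbK; apply/norP => -[hgw hne].
  (* Otherwise [w] still sees the colour of [g r']: the neighbour is [g r'] itself if dense, and
     [r'] if it lies in [dT]. *)
  have [||x [hx hxc]] := T_b_chromatic hwT (k := c (g r')).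
  - by exists (g r').
  - by move/(ext_inj_T (gT _) hwT)/eqP; rewrite eq_sym (negPf hne).
  have [hxT|hxT] := boolP (x \in T).
    by rewrite -(ext_inj_T hxT (gT _) hxc) e_sym hx in hgw.
  have := rest_unique hr' (nbr_cases hwT hx hxT); rewrite -gc in hxc.
  by move=> /(_ hxc) hxr; rewrite -hxr e_sym hx in hrw.
rewrite -(card_in_imset (f := g)); last first.
  move=> x y; rewrite [x \in _]inE [y \in _]inE => /andP[hx _] /andP[hy _] hxy.
  apply: rest_unique => //; last by rewrite gc hxy -gc.
  by move: hx; rewrite inE => /andP[].
apply: subset_leq_card; apply/subsetP => _ /imsetP[x hx ->].
case/setIdP: hx => hx hxr.
by rewrite inE g_free //= g_type.
Qed.
End Necessity.

(** * Sufficiency of the criterion *)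

(** Colours are represented by dense vertices. The vertices outside [A] are coloured one at a time,
    the degree bound leaving a colour for each. *)
Lemma greedy_extension (A : {set 'I_n}) (h : 'I_n -> 'I_n) :
  (forall v, v \in A -> h v \in T) ->
  (forall u v, u \in A -> v \in A -> e u v -> h u != h v) ->
  (forall v, v \notin A -> deg e v < #|T|) ->
  exists h' : 'I_n -> 'I_n, [/\ forall v, v \in A -> h' v = h v,
    forall v, h' v \in T & forall u v, e u v -> h' u != h' v].
Proof.
have [m] := ubnP #|~: A|; elim: m A h => // m IH A h hm hT hp hd.
have [hA|[x]] := set_0Vmem (~: A).
  have inA v : v \in A by have := in_set0 v; rewrite -hA inE => /negbFE.
  by exists h; split=> // [v|u v huv]; [apply: hT | apply: hp].
rewrite inE => hx.
(* The values at all neighbours are excluded, even the provisional ones outside [A]; the degree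
   bound covers these too. *)
have /card_gt0P[t] : 0 < #|T :\: h @: [set u | e x u]|.
  rewrite cardsD subn_gt0; apply: leq_ltn_trans (subset_leq_card (subsetIr _ _)) _.
  exact: leq_ltn_trans (leq_imset_card _ _) (hd x hx).
rewrite inE => /andP[htn htT].
pose h1 v := if v == x then t else h v.
have fresh u : e x u -> h u != t.
  by move=> hu; apply: contraNneq htn => <-; apply: imset_f; rewrite inE.
have [||||h' [h1' h2' h3']] := IH (x |: A) h1.
- by rewrite setCU setIC -setDE -ltnS (leq_trans _ hm) // ltnS [in X in _ < X](cardsD1 x) inE hx.
- by move=> v; rewrite in_setU1 /h1; case: eqP => //= _; apply: hT.
- move=> u v; rewrite !in_setU1 /h1.
  case: eqP => [->|_] /=; case: eqP => [->|_] //= hu hv huv.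
  + by rewrite e_irr in huv.
  + by rewrite eq_sym fresh.
  + by rewrite fresh // e_sym.
  + exact: hp.
- by move=> v; rewrite !inE negb_or => /andP[_]; apply: hd.
exists h'; split=> // v hv; rewrite h1' ?inE ?hv ?orbT // /h1.
by case: eqP => // hvx; rewrite -hvx hv in hx.
Qed.

(** Within one type every pair is compatible, so the i-th vertex of [rest] of that type is matched
    with the i-th free dense vertex of that cotype. The default of [nth] is never reached on
    [rest]. *)
Lemma free_card_matching : criterion -> exists g : 'I_n -> 'I_n,
  [/\ forall r, r \in rest -> g r \in free_dense,
      forall r, r \in rest -> cotype_in (g r) = type_in r &
      {in rest &, injective g}].
Proof.
move=> [_ hcard].
pose RX X := enum [set r in rest | type_in r == X].
pose FX X := enum [set u in free_dense | cotype_in u == X].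
pose g r := nth r (FX (type_in r)) (index r (RX (type_in r))).
have hin r : r \in rest -> r \in RX (type_in r).
  by move=> hr; rewrite mem_enum inE hr eqxx.
have hsz r : r \in rest -> index r (RX (type_in r)) < size (FX (type_in r)).
  move=> hr; apply: leq_trans (_ : size (RX (type_in r)) <= _).
    by rewrite index_mem hin.
  by rewrite -!cardE hcard.
have hg r : r \in rest -> g r \in FX (type_in r).
  by move=> hr; apply: mem_nth; apply: hsz.
have hF r : r \in rest -> (g r \in free_dense) && (cotype_in (g r) == type_in r).
  by move=> /hg; rewrite mem_enum inE.
exists g; split=> [r /hF/andP[]//|r /hF/andP[_ /eqP]//|r r' hr hr' hrr].
have ht : type_in r = type_in r'.
  by have /andP[_ /eqP <-] := hF _ hr; have /andP[_ /eqP <-] := hF _ hr'; rewrite hrr.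
have := hrr; rewrite /g (set_nth_default r' r) ?hsz // ht => /eqP.
rewrite nth_uniq ?enum_uniq -?ht ?hsz // ?ht ?hsz // => /eqP hi.
rewrite -[r](nth_index r (hin _ hr)) -[r'](nth_index r (hin _ hr')) ht.
by rewrite hi.
Qed.

Lemma criterion_sufficient : criterion -> has_b_precolouring_extension e S' c'.
Proof.
move=> hcrit; have [g [gF gtype ginj]] := free_card_matching hcrit.
have [hS1 _] := hcrit; have [hT hdeg] := tightG.
have [cpos [cprop [_ cuniq]]] := hc'.
have dST v : v \in S' -> v \in dT by apply: subsetP.
have ST v : v \in S' -> v \notin T by move/dST/deltaT_notin.
have exs v : exists t, (v \in S') ==> ((t \in T) && (c' v == c' t)).
  have [hv|hv] := boolP (v \in S'); last by exists v.
  by have [t ht htv] := hS1 v hv; exists t; rewrite /= ht htv eqxx.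
have [p hp] : exists p, forall v, v \in S' -> (p v \in T) && (c' v == c' (p v)).
  by exists (fun v => xchoose (exs v)) => v; apply/implyP; have := xchooseP (exs v).
(* [h v] is the dense vertex whose colour [v] receives; the final colouring is [c'] composed with
   the greedy extension of [h]. *)
pose h v := if v \in T then v else if v \in S' then p v else g v.
have hTid t : t \in T -> h t = t by rewrite /h => ->.
have hrest r : r \in rest -> h r = g r.
  by rewrite inE /h => /andP[/negPf -> /deltaT_notin/negPf ->].
have FT u : u \in free_dense -> u \in T by rewrite inE => /andP[].
have hSp s : s \in S' -> (h s \in T) && (c' s == c' (h s)).
  by move=> hs; rewrite /h (negPf (ST s hs)) hs hp.
have hD v : v \in S' :|: T -> (h v \in T) && (c' v == c' (h v)).
  by rewrite inE => /orP[/hSp //|hv]; rewrite hTid // hv eqxx.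
pose A := T :|: dT.
have Acases v : v \in A -> (v \in S' :|: T) || (v \in rest).
  by rewrite /rest !inE; case: (v \in S'); rewrite ?orbT //=; case: (dense e v).
have hAT v : v \in A -> h v \in T.
  move=> /Acases/orP[/hD/andP[] //|hv]; rewrite hrest //; exact/FT/gF.
have hSnotF s : s \in S' -> h s \notin free_dense.
  move=> hs; rewrite inE negb_and; apply/orP; right.
  rewrite negb_forall; apply/existsP; exists s; rewrite hs /= negbK.
  by case/andP: (hSp s hs).
have T_rest t r : t \in T -> r \in rest -> e t r -> t != g r.
  move=> ht hr htr; apply/eqP => htg.
  have : t \in type_in r by rewrite inE ht e_sym.
  by rewrite -gtype // -htg inE eqxx orbT andbF.
have D_rest v r : v \in S' :|: T -> r \in rest -> e v r -> h v != h r.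
  rewrite in_setU => hv hr hvr; rewrite (hrest r) //.
  case/orP: hv hvr => hv hvr; last by rewrite hTid // T_rest.
  by apply: contraNneq (hSnotF v hv) => ->; apply: gF.
have hprop u v : u \in A -> v \in A -> e u v -> h u != h v.
  move=> /Acases/orP[hu|hu] /Acases/orP[hv|hv] huv.
  - apply/eqP => huv2; apply: (cprop u v hu hv huv).
    by case/andP: (hD u hu) => _ /eqP->; case/andP: (hD v hv) => _ /eqP->; rewrite huv2.
  - exact: D_rest.
  - by rewrite eq_sym; apply: D_rest => //; rewrite e_sym.
  - rewrite !hrest //; apply/eqP => /(ginj _ _ hu hv) huv2.
    by rewrite huv2 e_irr in huv.
have hlow v : v \notin A -> deg e v < #|T|.
  rewrite !inE negb_or /dense -ltnNge hT => /andP[hv _]; lia.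
have {hlow} [h' [hh' h'T h'prop]] := greedy_extension hAT hprop hlow.
have h'id t : t \in T -> h' t = t by move=> ht; rewrite hh' ?hTid // inE ht.
have h'S s : s \in S' -> h' s = h s by move=> /dST hs; rewrite hh' // inE hs orbT.
have h'rest r : r \in rest -> h' r = g r.
  by move=> hr; rewrite hh' ?hrest // inE; move: hr; rewrite inE => /andP[_ ->]; rewrite orbT.
exists (c' \o h').
have Tdense t x : t \in T -> e t x -> x \in A.
  by move=> ht hx; rewrite inE; case: (boolP (x \in T)) => //= /(nbr_cases ht hx).
(* A dense [t] has [#|T|] - 1 neighbours, so once their colours are distinct they cover all of
   [T :\ t], and [t] is b-chromatic. *)
have nbr_inj t : t \in T -> {in [set x | e t x] &, injective h'}.
  move=> ht x y; rewrite !inE => hx hy hxy.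
  have hxA := Tdense t x ht hx; have hyA := Tdense t y ht hy.
  (* A vertex [a] of [S'] has no free colour; a dense [a] would equal [g b], but [t] is adjacent to
     [b] and hence not to [g b]. *)
  have main a b : a \in S' :|: T -> b \in rest -> e t a -> e t b -> h' a = h' b -> a = b.
    move=> ha hb hta htb; rewrite (h'rest b hb) => hab.
    move: ha; rewrite in_setU => /orP[ha|ha].
      by have := hSnotF a ha; rewrite -h'S // hab gF.
    rewrite h'id // in hab.
    have : t \in type_in b by rewrite inE ht e_sym.
    by rewrite -gtype // -hab inE e_sym hta andbF.
  case/orP: (Acases x hxA) => hx'; case/orP: (Acases y hyA) => hy'.
  (* If the common colour is free, both vertices are dense and [h'] fixes them. Otherwise it occurs
     on [S'], and the uniqueness condition of a partial b-colouring applies at [t]. *)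
  - have [hxF|hxF] := boolP (h' x \in free_dense).
      have inT z : z \in S' :|: T -> h' z \in free_dense -> z \in T.
        by rewrite inE => /orP[hz|//]; rewrite h'S // (negPf (hSnotF z hz)).
      have hyF : h' y \in free_dense by rewrite -hxy.
      by move: hxy; rewrite !h'id ?inT.
    have hDx := andP (hD x hx'); have hDy := andP (hD y hy').
    rewrite -!hh' // in hDx hDy; case: hDx => hxT /eqP hxc; case: hDy => hyT /eqP hyc.
    have hex : exists2 s, s \in S' & c' (h' x) = c' s.
      move: hxF; rewrite inE hxT /= negb_forall => /existsP[s].
      by rewrite negb_imply negbK => /andP[hs /eqP hsx]; exists s.
    have htx : t \in T :\ h' x.
      by rewrite in_setD1 ht andbT -{1}(h'id t ht) h'prop.
    have /eqP/cards1P[z hz] := cuniq _ hxT hex t htx.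
    have : x \in [set z] by rewrite -hz !inE in hx' *; rewrite hx' hx -hxc eqxx.
    have : y \in [set z] by rewrite -hz !inE in hy' *; rewrite hy' hy hyc hxy eqxx.
    by rewrite !inE => /eqP-> /eqP->.
  - exact: main.
  - by apply/esym/main.
  - by apply: ginj => //; rewrite -!h'rest.
split; [split; [split|]|split] => /=.
- by move=> v; apply: cpos; rewrite inE h'T orbT.
- by move=> u v huv /(dense_inj (h'T _) (h'T _)) huv2; have := h'prop u v huv; rewrite huv2 eqxx.
- move=> k [v <-]; exists (h' v); rewrite /= (h'id (h' v)) //; split=> // k' [v' <-] hne.
  rewrite /= (h'id (h' v)) // in hne.
  set t := h' v in hne *; have tT : t \in T by apply: h'T.
  have : h' v' \in h' @: [set x | e t x].
    suff -> : h' @: [set x | e t x] = T :\ t.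
      by rewrite in_setD1 h'T andbT; apply/eqP => hh; apply: hne; rewrite hh.
    apply/eqP; rewrite eqEcard; apply/andP; split.
      apply/subsetP => _ /imsetP[x + ->]; rewrite inE => hx.
      by rewrite in_setD1 h'T andbT -[X in _ != X](h'id t tT) eq_sym h'prop.
    rewrite (card_in_imset (nbr_inj t tT)) -/(deg e t) hdeg //.
    by have := cardsD1 t T; rewrite tT hT add1n => ->.
  by case/imsetP => [x hx hvx]; rewrite inE in hx; exists x; rewrite /= hvx.
- move=> v hv; have vA : v \in A.
    by move: hv; rewrite inE => /orP[/dST hv|hv]; rewrite inE hv ?orbT.
  by rewrite hh' //; case/andP: (hD v hv) => _ /eqP.
- move=> k hk r hr hrk; move: hk; rewrite leqNgt => /negP; apply; rewrite ltnS.
  suff : [set v in dT | c' (h' v) == k] \subset [set r].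
    by move=> /subset_leq_card; rewrite cards1.
  apply/subsetP => x; rewrite inE -hrk => /andP[hx /eqP/(dense_inj (h'T _) (h'T _))].
  rewrite (h'rest r) // inE => hxr.
  have [hxS|hxS] := boolP (x \in S').
    by have := hSnotF x hxS; rewrite -h'S // hxr gF.
  have hxR : x \in rest by rewrite /rest inE hxS.
  by apply/eqP/ginj => //; rewrite -hxr h'rest.
Qed.

Lemma has_extension_iff : has_b_precolouring_extension e S' c' <-> criterion.
Proof.
by split=> [[c hc]|]; [apply: criterion_necessary hc | apply: criterion_sufficient].
Qed.
End Criterion.

(** * A machine for counting formulas *)

(** [None] is reserved for positions past the end of the word, so that the end can be tested like a
    symbol. *)
Definition letter := option (option bool).

Definition letter_of (s : sym) : letter :=
  match s with S0 => Some (Some false) | S1 => Some (Some true) | SH => Some None end.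

Definition letter_at (w : seq sym) (i : nat) : letter := nth None (map letter_of w) i.

Lemma letter_at_end w i : (letter_at w i == None) = (size w <= i).
Proof.
rewrite /letter_at; case: (leqP (size w) i) => h.
  by rewrite nth_default ?size_map.
by rewrite (nth_map S0) //; case: (nth _ _ _).
Qed.

(* Variables range over positions.  [Count f g] binds in [g] the final value of
   a counter c that starts at 0 and is incremented at each position i with
   [f c i]; the current value of c is visible in [f]. *)
Inductive form :=
| Eq of nat & nat
| Lt of nat & nat
| Sym of nat & letter
| If of form & form & form
| Count of (nat -> nat -> form) & (nat -> form).

Fixpoint feval (w : seq sym) (a : form) : bool :=
  match a with
  | Eq x y => x == y
  | Lt x y => x < y
  | Sym x l => letter_at w x == l
  | If a b c => if feval w a then feval w b else feval w c
  | Count f g =>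
      feval w (g (foldl (fun c i => c + feval w (f c i)) 0 (iota 0 (size w))))
  end.

(* A variable of a formula is a number, read either as its value (by [feval]) or
   as the index of the tape track that stores it (by [compile]);
   [tracks env a a'] says that [a] is the track version of the value formula
   [a'] when track x holds [nth 0 env x]. *)
Inductive tracks : seq nat -> form -> form -> Prop :=
| tracksEq env x y : x < size env -> y < size env ->
    tracks env (Eq x y) (Eq (nth 0 env x) (nth 0 env y))
| tracksLt env x y : x < size env -> y < size env ->
    tracks env (Lt x y) (Lt (nth 0 env x) (nth 0 env y))
| tracksSym env x l : x < size env ->
    tracks env (Sym x l) (Sym (nth 0 env x) l)
| tracksIf env a b c a' b' c' :
    tracks env a a' -> tracks env b b' -> tracks env c c' ->
    tracks env (If a b c) (If a' b' c')
| tracksCount env f g f' g' :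
    (forall c i, tracks (rcons (rcons env c) i)
                        (f (size env) (size env).+1) (f' c i)) ->
    (forall c, tracks (rcons env c) (g (size env)) (g' c)) ->
    tracks env (Count f g) (Count f' g').

(** The number of tracks required when the first [d] are in use; bodies are unfolded by applying
    them to the fresh track indices [d] and [d.+1]. *)
Fixpoint width (d : nat) (a : form) : nat :=
  match a with
  | If a b c => maxn (width d a) (maxn (width d b) (width d c))
  | Count f g => maxn (width d.+2 (f d d.+1)) (width d.+1 (g d))
  | _ => d
  end.

Lemma width_ge d a : d <= width d a.
Proof.
elim: a d => //= [a IHa b _ c _|f IHf g _] d.
  exact: leq_trans (IHa d) (leq_maxl _ _).
by apply: leq_trans (leq_trans _ (IHf d d.+1 d.+2)) (leq_maxl _ _); rewrite ltnW.
Qed.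

Lemma set_nth_cat (s : seq nat) x y t :
  set_nth 0 (s ++ x :: t) (size s) y = s ++ y :: t.
Proof. by elim: s => //= z s ->. Qed.

(** * Sweeps over a tape with marks *)

Section Sweeps.
Variable K : nat.

Definition cell := (letter * {set 'I_K})%type.
(** Two bits of state suffice for all operations below. Only marks are rewritten, so the input word
    survives every sweep. *)
Definition sweep := bool * bool -> cell -> (bool * bool) * {set 'I_K}.

Fixpoint sweep_run (f : sweep) (q : bool * bool) (s : seq cell) :=
  match s with
  | [::] => (q, [::])
  | x :: s' => let r := f q x in let r' := sweep_run f r.1 s' in
               (r'.1, (x.1, r.2) :: r'.2)
  end.

Lemma sweep_run_letters f q s : map fst (sweep_run f q s).2 = map fst s.
Proof. by elim: s q => //= x s IH q; rewrite IH. Qed.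

Lemma sweep_run_cat f q s1 s2 :
  sweep_run f q (s1 ++ s2) =
  ((sweep_run f (sweep_run f q s1).1 s2).1,
   (sweep_run f q s1).2 ++ (sweep_run f (sweep_run f q s1).1 s2).2).
Proof. by elim: s1 q => [|x s1 IH] q /=; [case: sweep_run | rewrite IH]. Qed.

Lemma sweep_run_iota f (q : nat -> bool * bool) (x x' : nat -> cell) m k :
  (forall i, m <= i < m + k ->
     f (q i) (x i) = (q i.+1, (x' i).2) /\ (x' i).1 = (x i).1) ->
  sweep_run f (q m) [seq x i | i <- iota m k] =
  (q (m + k), [seq x' i | i <- iota m k]).
Proof.
elim: k m => [|k IH] m h /=; first by rewrite addn0.
have [-> h2] := h m ltac:(lia).
rewrite /= IH; last by move=> i hi; apply: h; lia.
by rewrite addSnnS -h2; case: (x' m).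
Qed.

Definition track (x : nat) : {set 'I_K} := [set j : 'I_K | j == x :> nat].
Definition marked (x : nat) (s : {set 'I_K}) : bool := [exists j : 'I_K, (j \in s) && (j == x :> nat)].
Definition marks (env : seq nat) (i : nat) : {set 'I_K} :=
  [set j : 'I_K | (j < size env) && (nth 0 env j == i)].

Lemma marked_marks env i x : x < size env -> size env <= K ->
  marked x (marks env i) = (nth 0 env x == i).
Proof.
move=> hx hK; apply/existsP/idP => [[j /andP[]]|h].
  by rewrite inE => /andP[_ h] /eqP <-.
by exists (Ordinal (leq_trans hx hK)); rewrite inE /= hx h eqxx.
Qed.

Definition sweep_eq x y : sweep := fun q c =>
  ((q.1 || marked x c.2 && marked y c.2, false), c.2).
Definition sweep_lt x y : sweep := fun q c =>
  ((q.1 || q.2 && marked y c.2, q.2 || marked x c.2), c.2).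
Definition sweep_sym x l : sweep := fun q c =>
  ((q.1 || marked x c.2 && (c.1 == l), false), c.2).
Definition sweep_init x : sweep := fun q c =>
  ((true, false), if q.1 then c.2 else c.2 :|: track x).
(** The first bit tells whether the previous cell carried the mark, which thus moves one cell to the
    right. *)
Definition sweep_inc x : sweep := fun q c =>
  ((marked x c.2, false), if q.1 then c.2 :|: track x else c.2 :\: track x).
Definition sweep_clear x : sweep := fun q c => ((false, false), c.2 :\: track x).

Section Tape.
Variable w : seq sym.
Let N := size w.

(** The additional cell accommodates the value [N], which a loop variable reaches on exit. *)
Definition tape (env : seq nat) : seq cell :=
  [seq (letter_at w i, marks env i) | i <- iota 0 N.+1].

Definition swept (f : sweep) (env : seq nat) := sweep_run f (false, false) (tape env).

(** Reduces the correctness of a sweep to a closed form [q i] of its state on arrival at cell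
    [i]. *)
Lemma swept_spec f env env' (q : nat -> bool * bool) : q 0 = (false, false) ->
  (forall i, i <= N ->
     f (q i) (letter_at w i, marks env i) = (q i.+1, marks env' i)) ->
  swept f env = (q N.+1, tape env').
Proof.
move=> q0 h; rewrite /swept -q0 /tape.
rewrite (@sweep_run_iota f q (fun i => (letter_at w i, marks env i))
  (fun i => (letter_at w i, marks env' i))) //.
by move=> i hi; rewrite h //=; lia.
Qed.

Variable env : seq nat.
Hypothesis (hK : size env <= K) (hN : all (fun v => v <= N) env).

Lemma env_le x : nth 0 env x <= N.
Proof.
case: (ltnP x (size env)) => hx; last by rewrite nth_default.
by have /allP := hN; apply; rewrite mem_nth.
Qed.

Lemma swept_eq x y : x < size env -> y < size env ->
  swept (sweep_eq x y) env = ((nth 0 env x == nth 0 env y, false), tape env).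
Proof.
move=> hx hy; have h := env_le x.
rewrite (@swept_spec _ _ env
   (fun i => ((nth 0 env x == nth 0 env y) && (nth 0 env x < i), false))).
- by rewrite ltnS h andbT.
- by rewrite andbF.
move=> i _; rewrite /sweep_eq !marked_marks //=; do 2 congr pair; lia.
Qed.

(* The second bit only records whether mark x has been passed. *)
Lemma swept_lt x y : x < size env -> y < size env ->
  exists b, swept (sweep_lt x y) env = ((nth 0 env x < nth 0 env y, b), tape env).
Proof.
move=> hx hy; have h := env_le y.
rewrite (@swept_spec _ _ env
   (fun i => ((nth 0 env x < nth 0 env y) && (nth 0 env y < i), nth 0 env x < i))).
- by rewrite !ltnS h andbT; eexists.
- by rewrite andbF.
move=> i _; rewrite /sweep_lt !marked_marks //=; do 2 congr pair; lia.
Qed.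

Lemma swept_sym x l : x < size env ->
  swept (sweep_sym x l) env = ((letter_at w (nth 0 env x) == l, false), tape env).
Proof.
move=> hx; have h := env_le x.
rewrite (@swept_spec _ _ env
   (fun i => ((letter_at w (nth 0 env x) == l) && (nth 0 env x < i), false))).
- by rewrite ltnS h andbT.
- by rewrite andbF.
move=> i _; rewrite /sweep_sym !marked_marks //=; do 2 congr pair.
case: (ltngtP (nth 0 env x) i) => [hi|hi|<-].
- by rewrite leqW // !andbT orbF.
- by rewrite leqNgt ltnS hi !andbF.
- by rewrite leqnn andbT andbF.
Qed.

Lemma swept_init : size env < K ->
  swept (sweep_init (size env)) env = ((true, false), tape (rcons env 0)).
Proof.
move=> hk; rewrite (@swept_spec _ _ (rcons env 0) (fun i => (0 < i, false))) //.
move=> i _; rewrite /sweep_init /=; congr pair.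
case: i => [|i] /=; apply/setP => j; rewrite !inE size_rcons nth_rcons ltnS;
  by case: (ltngtP j (size env)) => _ //=; rewrite ?orbF ?orbT.
Qed.

Lemma swept_inc x : x < size env -> nth 0 env x < N ->
  exists b, swept (sweep_inc x) env = (b, tape (set_nth 0 env x (nth 0 env x).+1)).
Proof.
move=> hx hv.
rewrite (@swept_spec _ _ (set_nth 0 env x (nth 0 env x).+1)
  (fun i => (((nth 0 env x).+1 == i), false))) //; first by eexists.
move=> i _; rewrite /sweep_inc marked_marks //=; congr pair.
have hm : maxn x.+1 (size env) = size env by apply/maxn_idPr.
apply/setP => j; rewrite (fun_if (fun A : {set 'I_K} => j \in A)) !inE.
rewrite size_set_nth hm nth_set_nth /=.
case: (eqVneq (j : nat) x) => [->|hj]; first by rewrite hx orbT eq_sym; case: ifP.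
by rewrite orbF; case: ifP.
Qed.
End Tape.

Lemma swept_clear w env v :
  swept w (sweep_clear (size env)) (rcons env v) = ((false, false), tape w env).
Proof.
rewrite (@swept_spec _ _ _ env (fun i => (false, false))) //.
move=> i _; rewrite /sweep_clear /=; congr pair.
apply/setP => j; rewrite !inE size_rcons nth_rcons ltnS.
by case: (ltngtP j (size env)) => _ //=; rewrite ?andbF ?andbT.
Qed.

(** * Compilation of formulas into programs of sweeps *)

(** The two numbers are the jump targets when the first bit of the final state is true, respectively
    false. *)
Definition instr := (sweep * nat * nat)%type.

Definition nop : instr := (fun q c => (q, c.2), 0, 0).

Definition sstep (C : seq instr) (z : nat * seq cell) : nat * seq cell :=
  if z.1 < size C then
    let i := nth nop C z.1 in
    let r := sweep_run i.1.1 (false, false) z.2 in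
    (if r.1.1 then i.1.2 else i.2, r.2)
  else z.

Lemma sstep_in C p s : p < size C -> sstep C (p, s) =
  let r := sweep_run (nth nop C p).1.1 (false, false) s in
  (if r.1.1 then (nth nop C p).1.2 else (nth nop C p).2, r.2).
Proof. by rewrite /sstep => ->. Qed.

Definition reaches C (T : nat) z z' : Prop :=
  exists2 t, t <= T & iter t (sstep C) z = z'.

Lemma reaches_refl C T z : reaches C T z z.
Proof. by exists 0. Qed.

Lemma reaches_trans C T1 T2 z1 z2 z3 :
  reaches C T1 z1 z2 -> reaches C T2 z2 z3 -> reaches C (T1 + T2) z1 z3.
Proof.
move=> [t1 h1 e1] [t2 h2 e2]; exists (t2 + t1); first lia.
by rewrite iterD e1.
Qed.

Lemma reaches_weaken C T1 T2 z1 z2 : T1 <= T2 -> reaches C T1 z1 z2 -> reaches C T2 z1 z2.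
Proof. by move=> h [t ht e]; exists t => //; apply: leq_trans h. Qed.

Fixpoint code_size (d : nat) (a : form) : nat :=
  match a with
  | If a b c => code_size d a + code_size d b + code_size d c
  | Count f g => 8 + code_size d.+2 (f d d.+1) + code_size d.+1 (g d)
  | _ => 1
  end.

(* Layout for [Count], whose counter is on track d and loop variable on track
   d+1: B, B+1 initialise, B+2 is the loop test, B+3 and B+4 increment the
   counter and the loop variable, B+5 to B+7 erase marks on exit; then come the
   codes of f and g. *)
Fixpoint compile (d : nat) (a : form) (B y n : nat) : seq instr :=
  match a with
  | Eq x1 x2 => [:: (sweep_eq x1 x2, y, n)]
  | Lt x1 x2 => [:: (sweep_lt x1 x2, y, n)]
  | Sym x l => [:: (sweep_sym x l, y, n)]
  | If a b c =>
      let B1 := B + code_size d a in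
      let B2 := B1 + code_size d b in
      compile d a B B1 B2 ++ compile d b B1 y n ++ compile d c B2 y n
  | Count f g =>
      let G := B + 8 + code_size d.+2 (f d d.+1) in
      [:: (sweep_init d, B + 1, B + 1);
          (sweep_init d.+1, B + 2, B + 2);
          (sweep_sym d.+1 None, B + 5, B + 8);
          (sweep_inc d, B + 4, B + 4);
          (sweep_inc d.+1, B + 2, B + 2);
          (sweep_clear d.+1, G, G);
          (sweep_clear d, y, y);
          (sweep_clear d, n, n)]
      ++ compile d.+2 (f d d.+1) (B + 8) (B + 3) (B + 4)
      ++ compile d.+1 (g d) G (B + 6) (B + 7)
  end.

Lemma size_compile d a B y n : size (compile d a B y n) = code_size d a.
Proof.
elim: a d B y n => //= [a IHa b IHb c IHc|f IHf g IHg] d B y n.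
  by rewrite !size_cat IHa IHb IHc addnA.
by rewrite !size_cat IHf IHg; lia.
Qed.

(** Ensures that program counters fit into the finite state set of the machine, the program being
    followed by two exit positions. *)
Lemma compile_targets d a B y n M :
  B + code_size d a <= M -> y < M -> n < M ->
  all (fun i : instr => (i.1.2 < M) && (i.2 < M)) (compile d a B y n).
Proof.
have pos d' a' : 0 < code_size d' a'.
  by elim: a' d' => //= a' IHa b' _ c' _ d'; rewrite -addnA addn_gt0 IHa.
elim: a d B y n => /= [x x'|x x'|x l|a IHa b IHb c IHc|f IHf g IHg] d B y n;
  try by move=> _ -> ->.
  move=> h hy hn; rewrite !all_cat IHa ?IHb ?IHc //; last 4 first; try lia.
  - by have := pos d c; lia.
  - by have := pos d b; have := pos d c; lia.
move=> h hy hn; have := pos d.+1 (g d).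
rewrite !all_cat IHf ?IHg //; by [lia | move=> ?; rewrite !andbT; lia].
Qed.

Definition code_at (C : seq instr) (B : nat) (F : seq instr) : Prop :=
  B + size F <= size C /\ forall j, j < size F -> nth nop C (B + j) = nth nop F j.

Lemma code_at_cat C B F1 F2 :
  code_at C B (F1 ++ F2) -> code_at C B F1 /\ code_at C (B + size F1) F2.
Proof.
rewrite /code_at size_cat => -[h1 h2]; split; split=> [|j hj]; try lia.
  by rewrite h2 ?nth_cat ?hj //; lia.
by rewrite -addnA h2 ?nth_cat ?ltnNge ?leq_addr ?addKn //; lia.
Qed.

(** The unit is one sweep. An iteration of [Count] adds a test and at most two increments to its
    body; the 5 stands for two initialisations, the last test and two erasures. *)
Fixpoint cost (N d : nat) (a : form) : nat :=
  match a with
  | If a b c => cost N d a + cost N d b + cost N d c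
  | Count f g => N * (cost N d.+2 (f d d.+1) + 3) + cost N d.+1 (g d) + 5
  | _ => 1
  end.

Lemma reaches_instr C B F w f p1 p2 env r j b :
  code_at C B F -> j < size F -> nth nop F j = (f, p1, p2) ->
  swept w f env = (b, r) ->
  reaches C 1 (B + j, tape w env) (if b.1 then p1 else p2, r).
Proof.
move=> [h1 h2] hj hF hs; exists 1; rewrite // [iter _ _ _]sstep_in; last lia.
by rewrite h2 // hF -/(swept w f env) hs.
Qed.

Lemma reaches_instr1 C B F w f p env r j b :
  code_at C B F -> j < size F -> nth nop F j = (f, p, p) ->
  swept w f env = (b, r) ->
  reaches C 1 (B + j, tape w env) (p, r).
Proof. by move=> h1 h2 h3 h4; have := reaches_instr h1 h2 h3 h4; case: ifP. Qed.

Lemma compile_correct w C env a a' B y n : tracks env a a' ->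
  width (size env) a <= K -> all (fun v => v <= size w) env ->
  code_at C B (compile (size env) a B y n) ->
  reaches C (cost (size w) (size env) a) (B, tape w env)
          (if feval w a' then y else n, tape w env).
Proof.
move=> ht; elim: ht B y n => {env a a'}
  [env x x' hx hx'|env x x' hx hx'|env x l hx
  |env a b c a' b' c' _ IHa _ IHb _ IHc|env f g f' g' _ IHf _ IHg] B y n /= hK hN hC.
- have := reaches_instr hC (j := 0) isT erefl (swept_eq hK hN hx hx').
  by rewrite addn0.
- have [q hq] := swept_lt hK hN hx hx'.
  by have := reaches_instr hC (j := 0) isT erefl hq; rewrite addn0.
- have := reaches_instr hC (j := 0) isT erefl (swept_sym hK hN l hx).
  by rewrite addn0.
- move: hK; rewrite !geq_max => /and3P[hKa hKb hKc].
  have [hCa /code_at_cat[hCb hCc]] := code_at_cat hC.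
  move: hCb hCc; rewrite !size_compile => hCb hCc.
  have /= := IHa _ _ _ hKa hN hCa; case: (feval w a') => h.
    apply: reaches_weaken (reaches_trans h (IHb _ _ _ hKb hN hCb)); lia.
  apply: reaches_weaken (reaches_trans h (IHc _ _ _ hKc hN hCc)); lia.
set d := size env in hK hC IHf IHg *.
set N := size w in hN IHf IHg *.
move: hK; rewrite geq_max => /andP[hKf hKg].
have hdK : d.+2 <= K by apply: leq_trans hKf; apply: width_ge.
rewrite -cat_cons -[_ :: _ ++ _]cat_cons in hC.
have {hC} [hH /code_at_cat[hCf hCg]] := code_at_cat (F1 := [:: _; _; _; _; _; _; _; _]) hC.
rewrite size_compile /= in hCf hCg.
set lf := code_size d.+2 (f d d.+1) in hH hCf hCg.
(* Loop invariant: after [i] rounds the last two tracks hold the count over the first [i] positions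
   and [i] itself. The bound on the count keeps its mark on the tape. *)
have stepc i : i <= N ->
  let c := foldl (fun c i => c + feval w (f' c i)) 0 (iota 0 i) in
  c <= i /\ reaches C (2 + i * (cost N d.+2 (f d d.+1) + 3)) (B, tape w env)
     (B + 2, tape w (rcons (rcons env c) i)).
  elim: i => [_ /=|i IH hi]; first split=> //.
    have h0 := reaches_instr1 hH (j := 0) isT erefl (swept_init w (ltnW hdK)).
    have sz : size (rcons env 0) = d.+1 by rewrite size_rcons.
    have h1 := swept_init w (env := rcons env 0); rewrite sz in h1.
    have {}h1 := reaches_instr1 hH (j := 1) isT erefl (h1 hdK).
    by rewrite addn0 in h0; apply: reaches_weaken (reaches_trans h0 h1).
  have [] := IH (ltnW hi).
  rewrite -[in iota 0 i.+1]addn1 iotaD foldl_cat /=.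
  set c := foldl _ _ _ => hc hr.
  set env2 := rcons (rcons env c) i in hr.
  have sz2 : size env2 = d.+2 by rewrite !size_rcons.
  have hK2 : size env2 <= K by rewrite sz2.
  have hN2 : all (fun v => v <= N) env2 by rewrite !all_rcons hN; lia.
  have n1 : nth 0 env2 d.+1 = i by rewrite /env2 nth_rcons size_rcons ltnn eqxx.
  have n0 : nth 0 env2 d = c
    by rewrite /env2 nth_rcons size_rcons ltnSn nth_rcons ltnn eqxx.
  have hd : d.+1 < size env2 by rewrite sz2.
  have h1 : reaches C 1 (B + 2, tape w env2) (B + 8, tape w env2).
    have := reaches_instr hH (j := 2) isT erefl (swept_sym hK2 hN2 None hd).
    by rewrite n1 letter_at_end -/N leqNgt hi.
  have h2 := IHf c i (B + 8) (B + 3) (B + 4).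
  rewrite -/env2 !sz2 in h2; have {}h2 := h2 hKf hN2 hCf.
  set c1 := c + _.
  have h3 : reaches C 1 (if feval w (f' c i) then B + 3 else B + 4, tape w env2)
                    (B + 4, tape w (rcons (rcons env c1) i)).
    rewrite /c1; case: (feval w (f' c i)); last by rewrite addn0; apply: reaches_refl.
    have hcN : nth 0 env2 d < N by rewrite n0; lia.
    have [|q hq] := swept_inc hK2 _ hcN; first by rewrite sz2.
    rewrite addn1; have -> : rcons (rcons env c.+1) i = set_nth 0 env2 d c.+1.
      by rewrite /env2 -!cats1 -!catA set_nth_cat.
    rewrite n0 in hq.
    exact: (reaches_instr1 hH (j := 3) isT erefl hq).
  have hc1 : c1 <= i.+1 by rewrite /c1; case: (feval _ _); lia.
  split=> //.
  set env3 := rcons (rcons env c1) i in h3.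
  have sz3 : size env3 = d.+2 by rewrite !size_rcons.
  have n3 : nth 0 env3 d.+1 = i by rewrite /env3 nth_rcons size_rcons ltnn eqxx.
  have hK3 : size env3 <= K by rewrite sz3.
  have hN3 : all (fun v => v <= N) env3 by rewrite !all_rcons hN; lia.
  have h4 : reaches C 1 (B + 4, tape w env3) (B + 2, tape w (rcons (rcons env c1) i.+1)).
    have hiN : nth 0 env3 d.+1 < N by rewrite n3.
    have [|q hq] := swept_inc hK3 _ hiN; first by rewrite sz3.
    have -> : rcons (rcons env c1) i.+1 = set_nth 0 env3 d.+1 i.+1.
      by rewrite /env3 -[in RHS]cats1 -(size_rcons env c1) set_nth_cat cats1.
    rewrite n3 in hq.
    exact: (reaches_instr1 hH (j := 4) isT erefl hq).
  apply: reaches_weaken (reaches_trans hr (reaches_trans h1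
    (reaches_trans h2 (reaches_trans h3 h4)))).
  by rewrite mulSn; lia.
(* The loop is left when its mark reaches cell [N], the only one with letter [None]. *)
have [hc hr] := stepc N (leqnn N).
set c := foldl _ _ _ in hc hr *.
set env2 := rcons (rcons env c) N in hr.
have sz2 : size env2 = d.+2 by rewrite !size_rcons.
have hK2 : size env2 <= K by rewrite sz2.
have hN2 : all (fun v => v <= N) env2 by rewrite !all_rcons hN; lia.
have n1 : nth 0 env2 d.+1 = N by rewrite /env2 nth_rcons size_rcons ltnn eqxx.
have hd : d.+1 < size env2 by rewrite sz2.
have h1 : reaches C 1 (B + 2, tape w env2) (B + 5, tape w env2).
  have := reaches_instr hH (j := 2) isT erefl (swept_sym hK2 hN2 None hd).
  by rewrite n1 letter_at_end -/N leqnn.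
have sz1 : size (rcons env c) = d.+1 by rewrite size_rcons.
have h2 : reaches C 1 (B + 5, tape w env2) (B + 8 + lf, tape w (rcons env c)).
  have hq := swept_clear w (rcons env c) N; rewrite sz1 in hq.
  exact: (reaches_instr1 hH (j := 5) isT erefl hq).
have h3 := IHg c (B + 8 + lf) (B + 6) (B + 7).
rewrite !sz1 in h3; have {}h3 := h3 hKg.
rewrite all_rcons hc hN in h3; have {}h3 := h3 isT hCg.
have h4 : reaches C 1 (if feval w (g' c) then B + 6 else B + 7, tape w (rcons env c))
                  (if feval w (g' c) then y else n, tape w env).
  case: (feval w (g' c)).
    exact: (reaches_instr1 hH (j := 6) isT erefl (swept_clear w env c)).
  exact: (reaches_instr1 hH (j := 7) isT erefl (swept_clear w env c)).
apply: reaches_weaken (reaches_trans hr (reaches_trans h1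
    (reaches_trans h2 (reaches_trans h3 h4)))).
by rewrite -/N; lia.
Qed.

Lemma tape_nil w :
  tape w [::] = rcons [seq (letter_of s, set0) | s <- w] (None, set0).
Proof.
apply: (@eq_from_nth _ (None, set0)); first by rewrite size_rcons !size_map size_iota.
move=> i; rewrite size_map size_iota => hi.
rewrite (nth_map 0) ?size_iota // nth_iota // add0n nth_rcons size_map.
have -> : marks [::] i = set0 by apply/setP => j; rewrite !inE.
case: ltngtP => [h||->]; rewrite ?(nth_map S0) //; try lia.
  by rewrite /letter_at (nth_map S0).
by rewrite /letter_at nth_default // size_map.
Qed.

(** * Realisation by a Turing machine *)

Section Machine.
Variable C : seq instr.
Hypothesis targets_ok :
  all (fun i : instr => (i.1.2 < (size C).+2) && (i.2 < (size C).+2)) C.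

(* Left summand: the three boot phases.  Right summand: a program counter with
   [None] (about to execute, head on the left end), [Some (Some q)] (sweeping
   right in sweep state q) or [Some None] (rewinding). *)
Definition state : finType :=
  (option bool + 'I_(size C).+2 * option (option (bool * bool)))%type.
Definition symbol : finType := option (option (letter * {set 'I_K})).

(* The last cell of the tape carries the letter [None], which bounds the sweeps. *)
Definition blank : symbol := None.
Definition left_end : symbol := Some None.
Definition in_cell (c : cell) : symbol := Some (Some c).

Definition ready (p : nat) : state := inr (inord p, None).
Definition rewinding (p : nat) : state := inr (inord p, Some None).
Definition sweeping (p : nat) (q : bool * bool) : state := inr (inord p, Some (Some q)).

(** Booting steps left of the input, writes [left_end] there, and puts the cell with letter [None]
    on the first blank. Each instruction is then a sweep up to that cell followed by a rewind. *)
Definition delta (q : state) (a : symbol) : option (state * symbol * move) :=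
  match q with
  | inl None => Some (inl (Some false), a, MoveL)
  | inl (Some false) => Some (inl (Some true), left_end, MoveR)
  | inl (Some true) =>
      if a is None then Some (rewinding 0, in_cell (None, set0), MoveL)
      else Some (q, a, MoveR)
  | inr (p, None) =>
      if p < size C then Some (sweeping p (false, false), a, MoveR) else None
  | inr (p, Some (Some q)) =>
      if a is Some (Some c) then
        let i := nth nop C p in
        let r := i.1.1 q c in
        let a' := in_cell (c.1, r.2) in
        if c.1 is None then Some (rewinding (if r.1.1 then i.1.2 else i.2), a', MoveL)
        else Some (sweeping p r.1, a', MoveR)
      else None
  | inr (p, Some None) =>
      if a is Some None then Some (ready p, a, Stay) else Some (q, a, MoveL)
  end.

Definition machine : TM :=
  {| tm_Q := state; tm_G := symbol; tm_blank := blank;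
     tm_in := fun s => in_cell (letter_of s, set0);
     tm_start := inl None; tm_delta := delta;
     tm_acc := fun q => if q is inr (p, None) then p == size C :> nat else false |}.

Lemma run_halted (M : TM) t (z : config M) : step z = None -> run t z = z.
Proof. by case: t => //= t ->. Qed.

Lemma run_step (M : TM) t (z : config M) :
  run t.+1 z = if step z is Some z' then run t z' else z.
Proof. by []. Qed.

Lemma run_add (M : TM) s t (z : config M) : run (s + t) z = run t (run s z).
Proof.
elim: s z => //= s IH z; case h: (step z) => [z'|]; first exact: IH.
by rewrite run_halted.
Qed.

Lemma run_until_halt (M : TM) s t (z z' : config M) :
  s <= t -> run s z = z' -> step z' = None -> run t z = z'.
Proof. by move=> /subnKC <- h hz; rewrite run_add h run_halted. Qed.

Definition at_start (z : nat * seq cell) : config machine :=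
  (ready z.1, [::], left_end :: map in_cell z.2).

Lemma step_at_start p s : size C <= p < (size C).+2 -> step (at_start (p, s)) = None.
Proof. by move=> /andP[h1 h2]; rewrite /= inordK // ltnNge h1. Qed.

Lemma accepting_at_start p s : p < (size C).+2 ->
  accepting (at_start (p, s)) = (p == size C).
Proof. by move=> h; rewrite /accepting /= inordK. Qed.

(** Taking [head] and [behead] of [s] treats uniformly a head on a cell and, for empty [l], a head
    already on the left end. *)
Lemma run_rewind p (l : seq cell) (r : seq symbol) :
  let s := map in_cell l ++ [:: left_end] in
  run (size l).+1 ((rewinding p, behead s, head blank s :: r) : config machine)
  = (ready p, [::], left_end :: map in_cell (rev l) ++ r).
Proof.
elim: l r => [|c l IH] r; first by rewrite /= {1}/ready inord_val.
cbv zeta; rewrite -[size (c :: l)]/((size l).+1) run_step /=.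
rewrite rev_cons map_rcons cat_rcons -IH.
by case: l {IH}.
Qed.

Lemma run_sweep p q (s : seq cell) (l r : seq symbol) :
  p < size C -> None \notin map fst s ->
  let z := sweep_run (nth nop C p).1.1 q s in
  run (size s) ((sweeping p q, l, map in_cell s ++ r) : config machine)
  = (sweeping p z.1, catrev (map in_cell z.2) l, r).
Proof.
move=> hp; have hp' : (inord p : 'I_(size C).+2) = p :> nat by rewrite inordK; lia.
elim: s q l => //= [[[x|] m] s IH] q l; rewrite in_cons //= => hs.
by rewrite hp' IH.
Qed.

Lemma run_sstep p s0 m : p < (size C).+2 -> None \notin map fst s0 ->
  let s := rcons s0 (None, m) in
  run (2 * size s0 + 3) (at_start (p, s)) = at_start (sstep C (p, s)).
Proof.
move=> hp hs0 s; rewrite /sstep /=; case: ltnP => hpC; last first.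
  by rewrite run_halted //= inordK // ltnNge hpC.
(* One step off the left end, one per inner cell, one on the last cell, and [(size s0).+1] for the
   rewind. *)
rewrite (_ : 2 * size s0 + 3 = 1 + (size s0 + (1 + (size s0).+1))); last lia.
rewrite !run_add /= inordK // hpC /=.
rewrite /s map_rcons -cats1 run_sweep // -cats1 sweep_run_cat /=.
set z := sweep_run _ _ s0; rewrite inordK //.
set r := (nth nop C p).1.1 _ _.
have hsz : size s0 = size z.2.
  by rewrite -(size_map fst z.2) sweep_run_letters size_map.
have := run_rewind (if r.1.1 then (nth nop C p).1.2 else (nth nop C p).2)
  (rev z.2) [:: in_cell (None, r.2)].
rewrite /= size_rev -hsz revK /at_start /= map_cat /= => <-.
rewrite catrevE map_rev.
by case: (rev (map _ _)).
Qed.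

Lemma run_iter_sstep w t p s :
  p < (size C).+2 -> map fst s = rcons (map letter_of w) None ->
  run (t * (2 * size w + 3)) (at_start (p, s)) = at_start (iter t (sstep C) (p, s)).
Proof.
elim: t p s => // t IH p s hp hs; rewrite mulSn run_add iterSr.
have -> : run (2 * size w + 3) (at_start (p, s)) = at_start (sstep C (p, s)).
  case/lastP: s hs => [|s0 [x m]]; first by case: (map _ w).
  rewrite map_rcons => /rcons_inj[hs /= ->].
  rewrite -(size_map letter_of w) -hs size_map run_sstep // hs.
  by elim: (w) => // -[] v; rewrite [map _ _]/= in_cons.
rewrite /sstep /=; case: ltnP => hpC; apply: IH; rewrite ?sweep_run_letters //.
have /= /andP[h1 h2] := all_nthP nop targets_ok _ hpC.
by case: ifP.
Qed.

Lemma run_scan (w : seq sym) (l r : seq symbol) :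
  run (size w) ((inl (Some true), l, map (@tm_in machine) w ++ r) : config machine)
  = (inl (Some true), catrev (map (@tm_in machine) w) l, r).
Proof. by elim: w l => //= s w IH l. Qed.

Lemma run_boot w : run (2 * size w + 4) (@init machine w) = at_start (0, tape w [::]).
Proof.
rewrite (_ : 2 * size w + 4 = 1 + (1 + (size w + (1 + (size w).+1)))); last lia.
rewrite !run_add tape_nil.
set z := run 1 (run 1 _).
(* On the empty word the first step leaves an explicit blank behind, hence the remainder [r]. *)
have [r [hr1 hr2 ->]] : exists r : seq symbol, [/\ head blank r = blank, behead r = [::] &
   z = (inl (Some true), [:: left_end], map (@tm_in machine) w ++ r)].
  by rewrite /z; case: (w) => [|s v]; [exists [:: blank] | exists [::]; rewrite cats0].
rewrite run_scan [run 1 _]/= hr1 hr2 catrevE -map_rev.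
have h := run_rewind 0 (rev [seq (letter_of s, set0) | s <- w]) [:: in_cell (None, set0)].
cbv zeta in h; rewrite size_rev size_map revK in h.
rewrite /at_start [fst _]/= [snd _]/= map_rcons -[rcons _ (in_cell _)]cats1 -h -map_rev -map_comp.
by case: (rev w).
Qed.
End Machine.
End Sweeps.

(** * Polynomial running time *)

(** As the base N + 2 is at least 2, its square absorbs a sum of three terms, and its fourth power
    absorbs the loop factor with the constants of [cost]. *)
Fixpoint cost_degree (d : nat) (a : form) : nat :=
  match a with
  | If a b c => cost_degree d a + cost_degree d b + cost_degree d c + 2
  | Count f g => cost_degree d.+2 (f d d.+1) + cost_degree d.+1 (g d) + 4
  | _ => 0
  end.

Lemma cost_poly N d a : cost N d a <= N.+2 ^ cost_degree d a.
Proof.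
elim: a d => //= [a IHa b IHb c IHc|f IHf g IHg] d.
  set x := cost_degree d a; set y := cost_degree d b; set z := cost_degree d c.
  have mono i : i <= x + y + z -> N.+2 ^ i <= N.+2 ^ (x + y + z) by apply: leq_pexp2l.
  have h1 := leq_trans (IHa d) (mono x ltac:(lia)).
  have h2 := leq_trans (IHb d) (mono y ltac:(lia)).
  have h3 := leq_trans (IHc d) (mono z ltac:(lia)).
  by rewrite expnD; set X := N.+2 ^ _ in h1 h2 h3 *; rewrite -mulnn; nia.
set x := cost_degree _ _; set y := cost_degree d.+1 _.
have mono i : i <= x + y -> N.+2 ^ i <= N.+2 ^ (x + y) by apply: leq_pexp2l.
have h1 := leq_trans (IHf d d.+1 d.+2) (mono x ltac:(lia)).
have h2 := leq_trans (IHg d d.+1) (mono y ltac:(lia)).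
have h3 : 0 < N.+2 ^ (x + y) by rewrite expn_gt0.
rewrite expnD; set X := N.+2 ^ (x + y) in h1 h2 h3 *.
apply: (@leq_trans (N.+2 * (4 * X) + 6 * X)).
  by apply: (@leq_trans (N * (4 * X) + 6 * X)); nia.
have h4 : 4 <= N.+2 * N.+2 by nia.
have h5 : 4 * N.+2 <= N.+2 * N.+2 * N.+2 by nia.
rewrite -[4]/(3.+1) !expnS expn0; nia.
Qed.

Theorem form_machine (a : form) (a' : form) : tracks [::] a a' ->
  exists (M : TM) (k : nat), forall w : seq sym,
    let c := @run M ((size w).+2 ^ k) (@init M w) in
    @halted M c /\ @accepting M c = feval w a'.
Proof.
move=> ha; pose K := width 0 a; pose s := code_size 0 a.
(* The exits [s] and [s.+1], just past the program, mean acceptance and rejection. *)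
pose C := compile K 0 a 0 s s.+1.
have sC : size C = s by apply: size_compile.
have tC : all (fun i : instr K => (i.1.2 < (size C).+2) && (i.2 < (size C).+2)) C.
  by apply: compile_targets; rewrite sC //; lia.
(* The exponent 4 pays for the length of each sweep and for booting. *)
exists (machine C), (cost_degree 0 a + 4) => w.
have cC : code_at C 0 (compile K 0 a 0 s s.+1) by split.
have [t ht hit] := compile_correct ha (w := w) (leqnn _) isT cC.
have hrun := run_iter_sstep tC t (w := w) (p := 0) (s := tape K w [::]) isT.
rewrite hit tape_nil map_rcons -map_comp in hrun.
have {}hrun := hrun erefl.
rewrite -tape_nil in hrun.
set T := t * _ in hrun.
set p := if _ then _ else _ in hrun.
have hp : size C <= p < (size C).+2 by rewrite /p sC; case: ifP; lia.
have hz := step_at_start (tape K w [::]) hp.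
have main z : z = at_start C (p, tape K w [::]) -> halted z /\ accepting z = feval w a'.
  move=> ->; rewrite /halted hz accepting_at_start; last by case/andP: hp.
  by split=> //; rewrite /p sC; case: (feval w a'); lia.
apply: main; apply: (@run_until_halt _ (2 * size w + 4 + T)) => //; last first.
  by rewrite run_add run_boot.
have hD := leq_trans ht (cost_poly (size w) 0 a).
have h1 : 0 < (size w).+2 ^ cost_degree 0 a by rewrite expn_gt0.
rewrite expnD /T; set X := _ ^ cost_degree 0 a in hD h1 *.
apply: (@leq_trans ((4 * (size w).+2) * X)); first nia.
have h4 : 4 * (size w).+2 <= (size w).+2 ^ 4.
  by rewrite !expnS expn0 muln1; set x := (size w).+2; have : 2 <= x by []; nia.
by rewrite mulnC leq_mul2l h4 orbT.
Qed.

(** * The criterion as a formula *)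

(** Atoms need a variable, so the constants are built on one bound by a dummy count. *)
Definition no : form := Count (fun c i => Eq c c) (fun c => Lt c c).
Definition yes : form := Count (fun c i => Eq c c) (fun c => Eq c c).
Definition fnot a := If a no yes.
Definition fand a b := If a b no.
Definition forr a b := If a yes b.
Definition fimp a b := If a b yes.
Definition fiff a b := If a b (fnot b).
Definition number (f : nat -> form) (k : nat -> form) := Count (fun _ i => f i) k.
Definition zero (k : nat -> form) := number (fun _ => no) k.
(* Yields 1 only on a nonempty word; [z] must be the value 0. *)
Definition one (z : nat) (k : nat -> form) := Count (fun c i => Eq c z) k.
Definition some (f : nat -> form) := number f (fun c => zero (fun z => Lt z c)).
Definition every (f : nat -> form) := fnot (some (fun i => fnot (f i))).
(* Addition saturates at the length of the word. *)
Definition plus (x y : nat) (k : nat -> form) :=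
  number (fun i => forr (Lt i x)
    (number (fun j => fand (fnot (Lt j x)) (Lt j i)) (fun t => Lt t y))) k.
Definition sym_at (x y : nat) (l : letter) := plus x y (fun z => Sym z l).

Definition sharp : letter := Some None.
Definition digit (b : bool) : letter := Some (Some b).

(** The counter follows the position up to the first separator and then lags behind for good. On an
    encoded instance the result is the number of vertices, the length of the first row. *)
Definition first_sharp (k : nat -> form) :=
  Count (fun c i => fand (Eq c i) (fnot (Sym i sharp))) k.
(* The position following the m-th separator, obtained as the number of
   positions preceded by fewer than m separators. *)
Definition after_sharps (m : nat) (k : nat -> form) :=
  number (fun i => number (fun p => fand (Lt p i) (Sym p sharp)) (fun c => Lt c m)) k.
(* Every record has three separators, so its fields start after separators
   3v, 3v+1 and 3v+2. *)
Definition field (v j : nat) (k : nat -> form) :=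
  plus v v (fun a => plus a v (fun b => plus b j (fun m => after_sharps m k))).


(** * Semantics of the derived formulas *)

Section Sem.
Variable w : seq sym.
Let N := size w.
Let W := map letter_of w.

Lemma feval_no : feval w no = false. Proof. by rewrite /= ltnn. Qed.
Lemma feval_not a : feval w (fnot a) = ~~ feval w a.
Proof. by rewrite [LHS]/= ltnn eqxx; case: ifP. Qed.
Lemma feval_and a b : feval w (fand a b) = feval w a && feval w b.
Proof. by rewrite [LHS]/= ltnn; case: (feval w a). Qed.
Lemma feval_or a b : feval w (forr a b) = feval w a || feval w b.
Proof. by rewrite [LHS]/= eqxx; case: (feval w a). Qed.
Lemma feval_imp a b : feval w (fimp a b) = (feval w a ==> feval w b).
Proof. by rewrite [LHS]/= eqxx; case: (feval w a). Qed.
Lemma feval_iff a b : feval w (fiff a b) = (feval w a == feval w b).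
Proof.
rewrite [LHS](_ : _ = if feval w a then feval w b else feval w (fnot b)) //.
by rewrite feval_not; case: (feval w a); case: (feval w b).
Qed.

Lemma foldl_count (p : nat -> bool) s c : foldl (fun c i => c + p i) c s = c + count p s.
Proof. by elim: s c => [|i s IH] c /=; rewrite ?addn0 // IH addnA. Qed.

Lemma feval_number f k :
  feval w (number f k) = feval w (k (count (fun i => feval w (f i)) (iota 0 N))).
Proof. by rewrite [LHS]/= foldl_count. Qed.

Lemma feval_zero k : feval w (zero k) = feval w (k 0).
Proof. by rewrite feval_number (eq_count (a2 := pred0)) ?count_pred0 // => i; rewrite feval_no. Qed.

Lemma feval_one k : feval w (one 0 k) = feval w (k (minn 1 N)).
Proof.
rewrite [feval w (one _ _)]/= -/N; case: N => // m /=; congr (feval w (k _)).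
by rewrite minnSS min0n; elim: (iota 1 m).
Qed.

Lemma feval_some f : feval w (some f) = has (fun i => feval w (f i)) (iota 0 N).
Proof. by rewrite feval_number feval_zero /= has_count. Qed.

Lemma feval_every f : feval w (every f) = all (fun i => feval w (f i)) (iota 0 N).
Proof.
rewrite feval_not feval_some -all_predC; apply: eq_all => i.
exact: etrans (congr1 negb (feval_not (f i))) (negbK _).
Qed.

Lemma count_interval x y m : count (fun j => x <= j < y) (iota 0 m) = minn y m - x.
Proof.
elim: m => [|m IH]; first by rewrite minn0.
by rewrite -addn1 iotaD count_cat IH /=; lia.
Qed.

(** A position [i] is below x + y exactly if [i < x] or fewer than [y] positions lie in the interval
    from [x] to [i]. *)
Lemma feval_plus x y k : feval w (plus x y k) = feval w (k (minn (x + y) N)).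
Proof.
rewrite feval_number; congr (feval w (k _)).
rewrite -[RHS]subn0 -count_interval; apply: eq_in_count => i.
rewrite mem_iota => /andP[_ hi]; rewrite feval_or feval_number.
rewrite (eq_count (a2 := fun j => x <= j < i)).
  by rewrite /= count_interval; lia.
by move=> j; rewrite feval_and feval_not /= -leqNgt.
Qed.

(** Saturation does no harm here, as all positions from [N] on have letter [None]. *)
Lemma feval_sym_at x y l : feval w (sym_at x y l) = (letter_at w (x + y) == l).
Proof.
rewrite feval_plus /=; case: (leqP (x + y) N) => h //.
by congr (_ == l); rewrite /letter_at !nth_default ?size_map //; lia.
Qed.

Lemma feval_first_sharp k n : n <= N ->
  (forall i, i < n -> letter_at w i != sharp) -> (n < N -> letter_at w n = sharp) ->
  feval w (first_sharp k) = feval w (k n).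
Proof.
move=> hn h1 h2; rewrite [feval w (first_sharp k)]/= -/N; congr (feval w (k _)).
set F := fun c i => _.
suff : forall m, m <= N -> foldl F 0 (iota 0 m) = minn m n.
  by move=> /(_ N (leqnn N)) ->; lia.
elim=> [|m IH] hm; first by rewrite min0n.
rewrite -addn1 iotaD foldl_cat IH 1?ltnW //= /F ltnn eqxx /= add0n.
case: (ltngtP m n) => hmn.
- by rewrite eqxx (negPf (h1 m hmn)) /=; lia.
- by rewrite (ltn_eqF hmn) /=; lia.
- by rewrite hmn eqxx h2 ?eqxx /=; lia.
Qed.

(** Since [A] ends with a separator, a position inside it is preceded by strictly fewer separators
    than [A] contains. The default of [last] admits the empty prefix of the first record. *)
Lemma feval_after_sharps A B k : W = A ++ B -> last sharp A = sharp ->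
  feval w (after_sharps (count_mem sharp A) k) = feval w (k (size A)).
Proof.
move=> hW hA; rewrite feval_number; congr (feval w (k _)).
have hsz : N = size A + size B by rewrite -size_cat -hW size_map.
rewrite (eq_in_count (a2 := fun i => 0 <= i < size A)).
  by rewrite count_interval; lia.
move=> i; rewrite mem_iota add0n => /andP[_ hi].
rewrite feval_number (eq_in_count (a2 := fun p => (p < i) && (nth None W p == sharp))).
  have -> : iota 0 N = iota 0 i ++ iota i (N - i) by rewrite -iotaD; congr iota; lia.
  rewrite count_cat.
  have -> : count (fun p => (p < i) && (nth None W p == sharp)) (iota i (N - i)) = 0.
    rewrite (eq_in_count (a2 := pred0)) ?count_pred0 // => p.
    by rewrite mem_iota => /andP[hp _]; rewrite ltnNge hp.
  have -> : count (fun p => (p < i) && (nth None W p == sharp)) (iota 0 i)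
      = count_mem sharp (take i W).
    rewrite -(map_nth_iota0 None) ?size_map; last lia.
    rewrite count_map; apply: eq_in_count => p.
    by rewrite mem_iota add0n => /andP[_ hp] /=; rewrite hp.
  rewrite /= addn0 hW take_cat; case: (ltnP i (size A)) => hiA; last first.
    by rewrite count_cat; lia.
  case/lastP: (A) hA hiA => [|A' x] //; rewrite last_rcons size_rcons ltnS => -> hiA.
  rewrite -cats1 takel_cat // count_cat /= ?eqxx /=.
  by rewrite addn0 addn1 ltnS -[in leqRHS](cat_take_drop i A') count_cat leq_addr.
by move=> p _; rewrite feval_and.
Qed.
End Sem.

Definition some_lt n f := some (fun i => fand (Lt i n) (f i)).
Definition every_lt n f := fnot (some_lt n (fun i => fnot (f i))).
Definition number_lt n f k := number (fun i => fand (Lt i n) (f i)) k.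

Lemma has_lt_ord n N (p : nat -> bool) : n <= N ->
  has (fun i => (i < n) && p i) (iota 0 N) = [exists v : 'I_n, p v].
Proof.
move=> hn; apply/hasP/existsP => [[i _ /andP[hi hp]]|[v hv]].
  by exists (Ordinal hi).
by exists (v : nat); rewrite ?ltn_ord // mem_iota /=; have := ltn_ord v; lia.
Qed.

Lemma count_lt_ord n N (p : nat -> bool) : n <= N ->
  count (fun i => (i < n) && p i) (iota 0 N) = #|[set v : 'I_n | p v]|.
Proof.
move=> hn; have -> : iota 0 N = iota 0 n ++ iota n (N - n) by rewrite -iotaD; congr iota; lia.
rewrite count_cat (eq_in_count (a1 := _) (a2 := pred0) (s := iota n _)) ?count_pred0 ?addn0; last first.
  by move=> i; rewrite mem_iota => /andP[h _]; rewrite ltnNge h.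
rewrite cardsE cardE /enum_mem size_filter -enumT -val_enum_ord count_map.
by apply: eq_count => v; rewrite /= ltn_ord.
Qed.

Section SemLt.
Variables (w : seq sym) (n : nat).
Hypothesis hn : n <= size w.

Lemma feval_some_lt f : feval w (some_lt n f) = [exists v : 'I_n, feval w (f v)].
Proof.
rewrite feval_some -(has_lt_ord (fun i => feval w (f i)) hn); apply: eq_has => i.
exact: feval_and.
Qed.

Lemma feval_every_lt f : feval w (every_lt n f) = [forall v : 'I_n, feval w (f v)].
Proof.
rewrite feval_not feval_some_lt negb_exists; apply: eq_forallb => v.
by rewrite feval_not negbK.
Qed.

Lemma feval_number_lt f k :
  feval w (number_lt n f k) = feval w (k #|[set v : 'I_n | feval w (f v)]|).
Proof.
rewrite feval_number -(count_lt_ord (fun i => feval w (f i)) hn).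
by congr (feval w (k _)); apply: eq_count => i; apply: feval_and.
Qed.
End SemLt.

Section Program.
(* [n] is the number of vertices; [z], [o], [t] are the values 0, 1, 2. *)
Variables n z o t : nat.
Definition p_edge v u := field v z (fun s => sym_at s u (digit true)).
Definition p_sel v := field v o (fun s => Sym s (digit true)).
Definition p_coloured v := field v t (fun s => fnot (Sym s sharp)).
(* S' is disjoint from T and c' is positive on their union, so T consists of the
   unselected vertices with a nonempty colour field. *)
Definition p_dense v := fand (fnot (p_sel v)) (p_coloured v).
(** Requiring equal bits, not merely equal letters, before [l] forces [l] to be the first separator
    of both fields. *)
Definition p_same_colour u v := field u t (fun a => field v t (fun b =>
  some (fun l => fand (fand (sym_at a l sharp) (sym_at b l sharp))
    (every (fun j => fimp (Lt j l)
      (forr (fand (sym_at a j (digit false)) (sym_at b j (digit false)))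
            (fand (sym_at a j (digit true)) (sym_at b j (digit true))))))))).
Definition p_rest v := fand (fand (fnot (p_sel v)) (fnot (p_coloured v)))
  (some_lt n (fun u => fand (p_dense u) (p_edge v u))).
Definition p_free u :=
  fand (p_dense u) (every_lt n (fun s => fimp (p_sel s) (fnot (p_same_colour s u)))).
Definition p_same_type r r' :=
  every_lt n (fun x => fimp (p_dense x) (fiff (p_edge r x) (p_edge r' x))).
Definition p_match r u :=
  every_lt n (fun x => fimp (p_dense x)
    (fiff (p_edge r x) (fnot (forr (p_edge u x) (Eq x u))))).
Definition p_criterion :=
  fand (every_lt n (fun s => fimp (p_sel s)
          (some_lt n (fun u => fand (p_dense u) (p_same_colour s u)))))
       (every_lt n (fun r => fimp (p_rest r)
          (number_lt n (fun r' => fand (p_rest r') (p_same_type r r')) (fun a =>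
           number_lt n (fun u => fand (p_free u) (p_match r u)) (fun b =>
           fnot (Lt b a)))))).
End Program.

Definition program :=
  first_sharp (fun n => zero (fun z => one z (fun o => plus o o (fun t =>
    p_criterion n z o t)))).

Lemma tracks_no env : tracks env no no.
Proof.
apply: tracksCount => [c i|c].
  have := @tracksEq (rcons (rcons env c) i) (size env) (size env).
  by rewrite !size_rcons leqnSn nth_rcons size_rcons ltnSn nth_rcons ltnn eqxx; apply.
have := @tracksLt (rcons env c) (size env) (size env).
by rewrite size_rcons ltnSn nth_rcons ltnn eqxx; apply.
Qed.

Lemma tracks_yes env : tracks env yes yes.
Proof.
apply: tracksCount => [c i|c].
  have := @tracksEq (rcons (rcons env c) i) (size env) (size env).
  by rewrite !size_rcons leqnSn nth_rcons size_rcons ltnSn nth_rcons ltnn eqxx; apply.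
have := @tracksEq (rcons env c) (size env) (size env).
by rewrite size_rcons ltnSn nth_rcons ltnn eqxx; apply.
Qed.

(** The program is parametric in its variables, so one term serves both readings; the derivation
    follows its syntax. *)
Lemma program_tracks : tracks [::] program program.
Proof.
repeat lazymatch goal with
 | |- tracks ?env no no => exact (tracks_no env)
 | |- tracks ?env yes yes => exact (tracks_yes env)
 | |- tracks ?env (Eq ?x ?y) _ => exact (@tracksEq env x y isT isT)
 | |- tracks ?env (Lt ?x ?y) _ => exact (@tracksLt env x y isT isT)
 | |- tracks ?env (Sym ?x ?l) _ => exact (@tracksSym env x l isT)
 | _ => first [ apply: tracksCount => *; rewrite ?[rcons _ _]/= ?[size _]/=
              | apply: tracksIf ]
 end.
Qed.

(** * Evaluation of the program on encoded instances *)

Definition nat_letters (m : nat) : seq letter := map letter_of (nat_bits m).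

Definition letters_value (s : seq letter) : nat :=
  foldr (fun l v => (l == digit true) + v.*2) 0 s.

(** Exposes the inner recursion of [nat_bits]: the number i + 1 has parity [~~ odd i] and half
    [uphalf i]. *)
Fixpoint digits (fuel m : nat) : seq letter :=
  match fuel, m with
  | k.+1, i.+1 => digit (~~ odd i) :: digits k (uphalf i)
  | _, _ => [::]
  end.

Lemma nat_lettersE m : nat_letters m = digits m m.
Proof.
rewrite /nat_letters /nat_bits; move: {1 3}m => k.
by elim: k m => [|k IH] [|i] //=; rewrite IH; case: (odd i).
Qed.

(** Makes the binary code injective, so that comparing fields compares colours. *)
Lemma nat_lettersK m : letters_value (nat_letters m) = m.
Proof.
rewrite nat_lettersE; suff : forall k i, i <= k -> letters_value (digits k i) = i by apply.
elim=> [|k IH] [|i] hi //=.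
rewrite IH; last by rewrite uphalf_half; have := odd_double_half i; case: (odd i) => /=; lia.
by have := odd_double_half i.+1; rewrite /= /digit; case: (odd i) => /=; lia.
Qed.

Lemma nat_letters_digit m l : l \in nat_letters m -> exists b, l = digit b.
Proof.
rewrite nat_lettersE; move: {1}m => k; elim: k m => [|k IH] [|i] //=.
by rewrite in_cons => /orP[/eqP->|/IH//]; exists (~~ odd i).
Qed.

Lemma nat_letters_sharp m : sharp \notin nat_letters m.
Proof. by apply/negP => /nat_letters_digit[]. Qed.

Lemma nat_letters_nil m : (nat_letters m == [::]) = (m == 0).
Proof.
apply/eqP/eqP => [h|->] //.
by rewrite -(nat_lettersK m) h.
Qed.

Section Encoded.
Variables (n : nat) (e : rel 'I_n) (S' : {set 'I_n}) (c' : 'I_n -> nat).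

Let w := encode e S' c'.
Let N := size w.
Let W := map letter_of w.
Let col (v : 'I_n) := if v \in S' :|: denseSet e then c' v else 0.

Definition adjacency_row (v : 'I_n) := [seq digit (e v u) | u <- enum 'I_n].
Definition record (v : 'I_n) :=
  adjacency_row v ++ sharp :: digit (v \in S') :: sharp :: nat_letters (col v) ++ [:: sharp].

Lemma letters_encode : W = flatten (map record (enum 'I_n)).
Proof.
have bitE b : letter_of (bit b) = digit b by case: b.
rewrite /W /w /encode map_flatten -map_comp; congr flatten; apply: eq_map => v.
rewrite /= !map_cat -map_comp /record /adjacency_row /= bitE.
rewrite map_cat; congr cat; apply: eq_map => u; exact: bitE.
Qed.

Lemma count_row v : count_mem sharp (adjacency_row v) = 0.
Proof. by rewrite count_map -(count_pred0 (enum 'I_n)); apply: eq_count. Qed.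

Lemma count_record v : count_mem sharp (record v) = 3.
Proof.
rewrite count_cat count_row /= count_cat /=.
by rewrite (count_memPn (nat_letters_sharp _)).
Qed.

Lemma count_records s : count_mem sharp (flatten (map record s)) = 3 * size s.
Proof. by elim: s => //= v s IH; rewrite count_cat count_record IH; lia. Qed.

Lemma last_records s : last sharp (flatten (map record s)) = sharp.
Proof.
elim/last_ind: s => // s v IH; rewrite map_rcons flatten_rcons last_cat /record.
by rewrite last_cat /= last_cat.
Qed.

(** Guarantees that the separator numbers, at most 3v + 2, do not saturate in [plus], and that
    vertices are positions of the word. *)
Lemma encode_size : 3 * n <= N.
Proof.
have := count_size (pred1 sharp) W; rewrite {1}letters_encode count_records.
by rewrite size_enum_ord size_map.
Qed.

Definition before (v : 'I_n) := flatten (map record (take v (enum 'I_n))).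
Definition after (v : 'I_n) := flatten (map record (drop v.+1 (enum 'I_n))).

Lemma encode_split v : W = before v ++ record v ++ after v.
Proof.
rewrite letters_encode -{1}(cat_take_drop v (enum 'I_n)) map_cat flatten_cat.
rewrite (drop_nth v) ?size_enum_ord // nth_ord_enum //.
Qed.

Lemma count_before v : count_mem sharp (before v) = 3 * v.
Proof. by rewrite count_records size_take size_enum_ord ltn_ord. Qed.

Lemma size_row v : size (adjacency_row v) = n.
Proof. by rewrite size_map size_enum_ord. Qed.

Lemma feval_field (v : 'I_n) j A B k : j <= 2 -> W = A ++ B -> last sharp A = sharp ->
  count_mem sharp A = 3 * v + j -> feval w (field v j k) = feval w (k (size A)).
Proof.
move=> hj hW hA hc; rewrite -(feval_after_sharps k hW hA) hc.
have h := encode_size; have hv := ltn_ord v.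
rewrite !feval_plus; congr (feval w (after_sharps _ k)).
rewrite -/N; lia.
Qed.

Lemma feval_field0 (v : 'I_n) k : feval w (field v 0 k) = feval w (k (size (before v))).
Proof.
apply: (feval_field _ _ (encode_split v)); rewrite ?last_records ?count_before //.
by rewrite addn0.
Qed.

Lemma feval_field1 (v : 'I_n) k :
  feval w (field v 1 k) = feval w (k (size (before v ++ adjacency_row v ++ [:: sharp]))).
Proof.
apply: (@feval_field v 1 _ (digit (v \in S') :: sharp :: nat_letters (col v) ++ [:: sharp] ++ after v)) => //.
- by rewrite (encode_split v) /record -!catA /= -?catA.
- by rewrite !last_cat.
- by rewrite !count_cat count_before count_row.
Qed.

Definition to_colour v :=
  before v ++ adjacency_row v ++ [:: sharp; digit (v \in S'); sharp].

Lemma to_colour_split v :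
  W = to_colour v ++ nat_letters (col v) ++ sharp :: after v.
Proof. by rewrite (encode_split v) /record /to_colour -!catA /= -?catA. Qed.

Lemma feval_field2 (v : 'I_n) k : feval w (field v 2 k) = feval w (k (size (to_colour v))).
Proof.
apply: (feval_field _ _ (to_colour_split v)) => //.
- by rewrite !last_cat.
- by rewrite !count_cat count_before count_row.
Qed.

Lemma feval_edge (v u : 'I_n) : feval w (p_edge 0 v u) = e v u.
Proof.
rewrite feval_field0 feval_sym_at /letter_at -/W (encode_split v).
rewrite nth_cat ltnNge leq_addr /= addKn /record -catA nth_cat size_row ltn_ord.
rewrite (nth_map u) ?size_enum_ord // nth_ord_enum.
by case: (e v u).
Qed.

Lemma feval_sel (v : 'I_n) : feval w (p_sel 1 v) = (v \in S').
Proof.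
rewrite feval_field1 /= /letter_at -/W.
have -> : W = (before v ++ adjacency_row v ++ [:: sharp]) ++
  (digit (v \in S') :: sharp :: nat_letters (col v) ++ [:: sharp] ++ after v).
  by rewrite (encode_split v) /record -!catA /= -?catA.
by rewrite nth_cat ltnn subnn /=; case: (v \in S').
Qed.

Lemma letter_at_colour v j :
  letter_at w (size (to_colour v) + j) = nth None (nat_letters (col v) ++ sharp :: after v) j.
Proof. by rewrite /letter_at -/W (to_colour_split v) nth_cat ltnNge leq_addr /= addKn. Qed.

Lemma feval_coloured (v : 'I_n) : feval w (p_coloured 2 v) = (col v != 0).
Proof.
rewrite feval_field2 feval_not /= -[size _]addn0 letter_at_colour -nat_letters_nil.
have := @nat_letters_sharp (col v); case: (nat_letters _) => //= l s.
by rewrite in_cons negb_or eq_sym => /andP[].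
Qed.

Lemma feval_same_colour (u v : 'I_n) : feval w (p_same_colour 2 u v) = (col u == col v).
Proof.
rewrite feval_field2 feval_field2 feval_some.
set x := nat_letters (col u); set y := nat_letters (col v).
have nthx l : letter_at w (size (to_colour u) + l) = nth None (x ++ sharp :: after u) l.
  exact: letter_at_colour.
have nthy l : letter_at w (size (to_colour v) + l) = nth None (y ++ sharp :: after v) l.
  exact: letter_at_colour.
(* The length [l] is searched among the positions of the word, so it has to be below [N]. *)
have szx : size x < N.
  by rewrite /N -(size_map letter_of) -/W (to_colour_split u) !size_cat /=
     -/x addnCA -addn1 leq_add2l addn_gt0 orbT.
pose agree j := (nth None (x ++ sharp :: after u) j == digit false) &&
                (nth None (y ++ sharp :: after v) j == digit false) ||
                (nth None (x ++ sharp :: after u) j == digit true) &&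
                (nth None (y ++ sharp :: after v) j == digit true).
rewrite (eq_has (a2 := fun l => [&& nth None (x ++ sharp :: after u) l == sharp,
   nth None (y ++ sharp :: after v) l == sharp & all (fun j => (j < l) ==> agree j) (iota 0 N)])).
  apply/hasP/eqP => [[l]|huv].
    rewrite mem_iota => /andP[_ hlN] /and3P[hx hy /allP hj].
    have hag j : j < l -> agree j.
      by move=> hjl; have := hj j; rewrite mem_iota hjl; apply; lia.
    have szl s (r : seq letter) : sharp \notin s -> nth None (s ++ sharp :: r) l == sharp ->
      (forall j, j < l -> nth None (s ++ sharp :: r) j != sharp) -> size s = l.
      move=> hs hl hlt; case: (ltngtP (size s) l) => // h.
        by have := hlt _ h; rewrite nth_cat ltnn subnn.
      by move: hl; rewrite nth_cat h => /eqP hl; rewrite -hl mem_nth in hs.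
    have sx : size x = l.
      apply: (szl x (after u)) => //; first exact: nat_letters_sharp.
      by move=> j /hag; rewrite /agree => /orP[]/andP[/eqP-> _].
    have sy : size y = l.
      apply: (szl y (after v)) => //; first exact: nat_letters_sharp.
      by move=> j /hag; rewrite /agree => /orP[]/andP[_ /eqP->].
    rewrite -(nat_lettersK (col u)) -(nat_lettersK (col v)) -/x -/y; congr letters_value.
    apply: (@eq_from_nth _ None); first by rewrite sx sy.
    move=> j hjx; have := hag j; rewrite -sx => /(_ hjx); rewrite /agree !nth_cat hjx sy -sx hjx.
    by case/orP => /andP[/eqP-> /eqP->].
  have xy : x = y by rewrite /x huv.
  exists (size x); first by rewrite mem_iota.
  rewrite -xy !nth_cat ltnn subnn /=; apply/allP => j _; apply/implyP => hj.
  rewrite /agree -xy !nth_cat hj.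
  have [b ->] := nat_letters_digit (mem_nth None hj).
  by case: b.
move=> l; rewrite !feval_and !feval_sym_at feval_every nthx nthy -andbA.
congr [&& _, _ & _]; apply: eq_all => j.
by rewrite feval_imp feval_or !feval_and !feval_sym_at nthx nthy.
Qed.

Hypothesis (e_sym : symmetric e).
Hypothesis (hS : S' \subset deltaT e (denseSet e)).
Hypothesis (hc' : partial_b_colouring e S' c').

Lemma col_neq0 v : (col v != 0) = (v \in S' :|: denseSet e).
Proof.
rewrite /col; case: ifP => // hv; case: hc' => h _.
by rewrite -lt0n h.
Qed.

Lemma notin_S v : v \in denseSet e -> v \notin S'.
Proof.
by move=> hv; apply: contraTN hv => /(subsetP hS); apply: deltaT_notin.
Qed.

Lemma feval_dense (v : 'I_n) : feval w (p_dense 1 2 v) = (v \in denseSet e).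
Proof.
rewrite feval_and feval_not feval_sel feval_coloured col_neq0 in_setU.
by case hv: (v \in denseSet e); [rewrite (notin_S hv) orbT | case: (v \in S')].
Qed.

Lemma n_le_N : n <= N. Proof. by have := encode_size; lia. Qed.

Lemma feval_rest (v : 'I_n) : feval w (p_rest n 0 1 2 v) = (v \in rest e S').
Proof.
rewrite feval_and feval_and !feval_not feval_sel feval_coloured col_neq0 in_setU.
rewrite (feval_some_lt n_le_N) in_setD [v \in deltaT _ _]inE.
rewrite (eq_existsb (P2 := fun u => (u \in denseSet e) && e u v)); last first.
  by move=> u; rewrite feval_and feval_dense feval_edge e_sym.
by case: (v \in S') => //=; rewrite andbC.
Qed.

Lemma feval_free (u : 'I_n) : feval w (p_free n 1 2 u) = (u \in free_dense e S' c').
Proof.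
rewrite feval_and feval_dense (feval_every_lt n_le_N) [in RHS]inE.
case hu: (u \in denseSet e) => //; congr (_ && _); apply: eq_forallb => s.
rewrite feval_imp feval_sel feval_not feval_same_colour.
by case hs: (s \in S') => //=; rewrite /col !in_setU hs hu orbT.
Qed.

Lemma eq_set_dense (P Q : pred 'I_n) :
  [forall x, (x \in denseSet e) ==> (P x == Q x)] =
  ([set x in denseSet e | P x] == [set x in denseSet e | Q x]).
Proof.
apply/forallP/eqP => [h|h x].
  by apply/setP => x; rewrite [LHS]inE [RHS]inE; have := h x; case: (x \in _) => //= /eqP.
by have := congr1 (fun A : {set 'I_n} => x \in A) h; rewrite /= [LHS]inE [RHS]inE; case: (x \in _) => //= ->.
Qed.

Lemma feval_same_type (r r' : 'I_n) :
  feval w (p_same_type n 0 1 2 r r') = (type_in e r' == type_in e r).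
Proof.
rewrite (feval_every_lt n_le_N) eq_sym -eq_set_dense; apply: eq_forallb => x.
by rewrite feval_imp feval_iff feval_dense !feval_edge.
Qed.

Lemma feval_match (r u : 'I_n) :
  feval w (p_match n 0 1 2 r u) = (cotype_in e u == type_in e r).
Proof.
rewrite (feval_every_lt n_le_N) eq_sym -eq_set_dense; apply: eq_forallb => x.
by rewrite feval_imp feval_iff feval_dense feval_not feval_or !feval_edge.
Qed.

Lemma feval_criterion : feval w (p_criterion n 0 1 2) <-> criterion e S' c'.
Proof.
have sel (s : 'I_n) : feval w (fimp (p_sel 1 s)
    (some_lt n (fun u => fand (p_dense 1 2 u) (p_same_colour 2 s u)))) =
    ((s \in S') ==> [exists t in denseSet e, c' s == c' t]).
  rewrite feval_imp feval_sel (feval_some_lt n_le_N).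
  case hs: (s \in S') => //; congr (_ ==> _); apply: eq_existsb => t.
  rewrite feval_and feval_dense feval_same_colour.
  by case ht: (t \in denseSet e) => //=; rewrite /col !in_setU hs ht orbT.
have unmatched (r : 'I_n) : feval w (fimp (p_rest n 0 1 2 r)
    (number_lt n (fun r' => fand (p_rest n 0 1 2 r') (p_same_type n 0 1 2 r r')) (fun a =>
     number_lt n (fun u => fand (p_free n 1 2 u) (p_match n 0 1 2 r u)) (fun b =>
     fnot (Lt b a))))) =
    ((r \in rest e S') ==>
     (#|[set r' in rest e S' | type_in e r' == type_in e r]| <=
      #|[set u in free_dense e S' c' | cotype_in e u == type_in e r]|)).
  rewrite feval_imp feval_rest !(feval_number_lt n_le_N) feval_not.
  have ltE a b : feval w (Lt a b) = (a < b) by [].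
  rewrite ltE -leqNgt; congr (_ ==> (_ <= _)).
    by apply: eq_card => x; rewrite [LHS]in_set feval_and feval_rest feval_same_type [RHS]in_set.
  by apply: eq_card => x; rewrite [LHS]in_set feval_and feval_free feval_match [RHS]in_set.
rewrite feval_and !(feval_every_lt n_le_N); split.
  move=> /andP[/forallP h1 /forallP h2]; split=> [s hs|r hr].
    by have := h1 s; rewrite sel hs => /exists_inP[t ht /eqP]; exists t.
  by have := h2 r; rewrite unmatched hr.
move=> [h1 h2]; apply/andP; split; apply/forallP => x.
  rewrite sel; apply/implyP => /h1[t ht hxt]; apply/exists_inP; exists t => //; exact/eqP.
by rewrite unmatched; apply/implyP/h2.
Qed.

Lemma feval_program : feval w program <-> criterion e S' c'.
Proof.
rewrite -feval_criterion.
have h3 := encode_size.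
have hfirst k : feval w (first_sharp k) = feval w (k n).
  apply: feval_first_sharp => [|i hi|hN]; first exact: n_le_N.
    have n_gt0 : 0 < n by lia.
    rewrite /letter_at -/W (encode_split (Ordinal n_gt0)).
    rewrite [before _]/before take0 /= /record -catA nth_cat size_row hi.
    by rewrite (nth_map (Ordinal hi)) ?size_enum_ord.
  have n_gt0 : 0 < n.
    rewrite lt0n; apply: contraTneq hN => n0; rewrite n0 -leqNgt -/N.
    by rewrite /N -(size_map letter_of) -/W letters_encode size_flatten sumnE big_map
      big_map big_enum big1 // => v; have := ltn_ord v; rewrite {2}n0.
  rewrite /letter_at -/W (encode_split (Ordinal n_gt0)).
  by rewrite [before _]/before take0 /= /record -catA nth_cat size_row ltnn subnn.
rewrite hfirst feval_zero feval_one feval_plus.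
(* For positive [n] the word has at least three letters and the constants 1 and 2 are exact. For
   [n = 0] they may saturate, but every quantifier over vertices is vacuous. *)
have [n0|n_gt0] := posnP n; last by rewrite -/N !(minn_idPl _) //; lia.
have all0 f : feval w (every_lt n f).
  rewrite (feval_every_lt n_le_N); apply/forallP => v.
  by have := ltn_ord v; rewrite {2}n0.
by rewrite !feval_and !all0.
Qed.
End Encoded.

Theorem mainTheorem6 :
  exists (M : TM) (k : nat),
    forall (n : nat) (e : rel 'I_n) (S' : {set 'I_n}) (c' : 'I_n -> nat),
      symmetric e -> irreflexive e -> tight e ->
      S' \subset deltaT e (denseSet e) ->
      partial_b_colouring e S' c' ->
      let w := encode e S' c' in
      let c := @run M ((size w).+2 ^ k) (@init M w) in
      @halted M c /\ (@accepting M c <-> has_b_precolouring_extension e S' c').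
Proof.
have [M [k hM]] := form_machine program_tracks.
exists M, k => n e S' c' e_sym e_irr tightG hS hc'.
have [hhalt hacc] := hM (encode e S' c').
split=> //; rewrite hacc.
have [h1 h2] := feval_program e_sym hS hc'.
have [h3 h4] := has_extension_iff e_sym e_irr tightG hS hc'.
by split=> [/h1/h4|/h3/h2].
Qed.
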